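(* Let $\mathcal A$ be a circular array (disk) of radius $a$, and consider $N$ dipoles at $\vec y_j=(y_j,L+\eta_j)$ with polarization vectors $\vec p_j=(p_j,p_{j,z})\in\mathbb C^3$, $p_j\in\mathbb C^2$, $\|\vec p_j\|=\mathcal O(1)$, $j=1,\dots,N$. In the Fraunhofer asymptotic regime, the $2\times2$ system $$\mathbb H_{1:2,1:2}(\vec y,\vec y;k)\,p=\mathcal I_{\mathrm{KM}}(\vec y;k)$$ for the unknown $p\in\mathbb C^2$ is invertible. Its solution $p$ (which depends on the imaging point $\vec y=(y,L+\eta)$) approximates the true cross-range polarization vectors in the following sense. (i) If the imaging point coincides with a dipole, i.e. $\vec y=\vec y_i$, then $$\|p-p_i\|=\mathcal O\Big(\frac{L}{a\,k\,\min_{j\ne i}\|y_i-y_j\|}\Big)+\mathcal O\Big(\frac bL\Big)+\mathcal O\Big(\frac{a^2\Theta_a}{L^2}\Big)+\mathcal O(\Theta_b).$$ (ii) If $y\ne y_j$ for all $j=1,\dots,N$, then $$\|p\|=\mathcal O\Big(\frac{L}{a\,k\,\min_{j=1,\dots,N}\|y-y_j\|}\Big)+\mathcal O\Big(\frac{a^2\Theta_a}{L^2}\Big)+\mathcal O(\Theta_b).$$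
   Context: Notation. Points of $\mathbb R^3$ are written $\vec x=(x,z)$ with $x\in\mathbb R^2$ the cross-range part and $z$ the range part. $c>0$ is the wave speed, $\mu>0$ the magnetic permeability, $\omega>0$ the angular frequency, $k=\omega/c$. With $\vec r=\vec x-\vec y$, $r=\|\vec r\|$, $m(kr)=(\mathrm i kr-1)/(kr)^2$, and $G(\vec x,\vec y;k)=\frac{e^{\mathrm i k\|\vec x-\vec y\|}}{4\pi\|\vec x-\vec y\|}$, the dyadic Green function is the $3\times3$ matrix $$\mathbb G(\vec x,\vec y;k)=G(\vec x,\vec y;k)\Big[(1+m(kr))\mathbb I-(1+3m(kr))\frac{\vec r\,\vec r^{\top}}{r^2}\Big].$$ Array, data, image. $\mathcal A=\{x_r\in\mathbb R^2:\|x_r\|\le a\}$, receivers are $\vec x_r=(x_r,0)$, $x_r\in\mathcal A$. The data are $\vec\Pi(x_r;k)=\mu\omega^2\sum_{j=1}^N\mathbb G(\vec x_r,\vec y_j;k)\vec p_j$, and the Kirchhoff imaging function is $$\vec{\mathcal I}_{\mathrm{KM}}(\vec y;k)=(\mu\omega^2)^{-1}\int_{\mathcal A}\overline{\mathbb G(\vec x_r,\vec y;k)}\,\vec\Pi(x_r;k)\,\mathrm dx_r=\sum_{j=1}^N\mathbb H(\vec y,\vec y_j;k)\vec p_j,\qquad \mathbb H(\vec y,\vec y';k)=\int_{\mathcal A}\overline{\mathbb G(\vec x_r,\vec y;k)}\,\mathbb G(\vec x_r,\vec y';k)\,\mathrm dx_r .$$ $\mathcal I_{\mathrm{KM}}(\vec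 y;k)\in\mathbb C^2$ denotes the first two components of $\vec{\mathcal I}_{\mathrm{KM}}(\vec y;k)$, and $\mathbb H_{1:2,1:2}$ the leading $2\times2$ principal submatrix of $\mathbb H$. Fraunhofer regime. Imaging points and dipole positions lie in the imaging window: they are of the form $(y,L+\eta)$ with $\|y\|=\mathcal O(b)$ and $|\eta|=\mathcal O(h)$. Put $\Theta_a=ka^2/L$, $\Theta_b=kb^2/L$, $\Theta_h=kh^2/L$. The parameters $(k,L,a,b,h)$ vary so that $kL\gg1$, $a\ll L$, $b\ll L$, $h\ll L$, $\Theta_b\ll1$, $1\ll\Theta_a\ll L^2/a^2$ and $kh=\mathcal O(1)$, where $X\ll Y$ means $X/Y\to0$; $N$ is fixed. ''In the Fraunhofer regime'' means sufficiently far along this limit, and $\mathcal O$, $o$ refer to this limit, uniformly over points of the imaging window. The term with $\min_{j\neq i}$ is absent if $N=1$, and the estimate in (i) is understood for dipoles with $y_j\ne y_i$, $j\neq i$ (it is void otherwise). *)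

(* Defs.v *)
From HB Require Import structures.
From mathcomp Require Import all_boot all_order all_algebra.
From mathcomp Require Import all_classical all_reals all_analysis.
From mathcomp Require Import complex.

Set Implicit Arguments.
Unset Strict Implicit.
Unset Printing Implicit Defensive.

Import Order.TTheory GRing.Theory Num.Theory.
Import numFieldNormedType.Exports.

Local Open Scope classical_set_scope.
Local Open Scope ring_scope.
Local Open Scope complex_scope.

Section Vectors.
Context {R : realType}.

(* Euclidean norms; the norm `|_| that the library puts on matrices is the
   sup norm. *)
Definition enorm n (v : 'cV[R]_n) : R :=
  Num.sqrt (\sum_i v i ord0 ^+ 2).

Definition cnorm n (v : 'cV[R[i]]_n) : R :=
  Num.sqrt (\sum_i Normc.normc (v i ord0) ^+ 2).

(* The point (x, z) of R^3 with cross-range part x and range part z. *)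
Definition mkpoint (x : 'cV[R]_2) (z : R) : 'cV[R]_(2 + 1) := col_mx x z%:M.

(* R^2 is R * R for integration (product Lebesgue measure) and 'cV[R]_2 for
   linear algebra. *)
Definition cvec (u : R * R) : 'cV[R]_2 :=
  \col_(i < 2) if i == ord0 then u.1 else u.2.

Definition disk (a : R) : set (R * R) := [set u | enorm (cvec u) <= a].

Definition Cintegral (D : set (R * R)) (f : R * R -> R[i]) : R[i] :=
  let mu := (@lebesgue_measure R \x @lebesgue_measure R)%E in
  Rintegral mu D (fun u => complex.Re (f u)) +i*
  Rintegral mu D (fun u => complex.Im (f u)).

Definition mxintegral m n (D : set (R * R)) (f : R * R -> 'M[R[i]]_(m, n)) :
    'M[R[i]]_(m, n) :=
  \matrix_(i, j) Cintegral D (fun u => f u i j).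

End Vectors.

Section Imaging.
Context {R : realType}.

Definition expi (t : R) : R[i] := cos t +i* sin t.

Definition green (x y : 'cV[R]_(2 + 1)) (k : R) : R[i] :=
  expi (k * enorm (x - y)) / (4 * pi * enorm (x - y))%:C.

Definition mfun (s : R) : R[i] := ('i * s%:C - 1) / (s ^+ 2)%:C.

Definition dyadic_green (x y : 'cV[R]_(2 + 1)) (k : R) : 'M[R[i]]_(2 + 1) :=
  let r := x - y in
  let m := mfun (k * enorm r) in
  green x y k *:
    ((1 + m) *: 1%:M
     - (1 + 3 * m) *: map_mx (fun t => t%:C) ((enorm r ^+ 2)^-1 *: (r *m r^T))).

Definition receiver (u : R * R) : 'cV[R]_(2 + 1) := mkpoint (cvec u) 0.

Definition conj_mx m n (A : 'M[R[i]]_(m, n)) : 'M[R[i]]_(m, n) :=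
  map_mx (fun z => z^*) A.

(* y j : position and p j : polarization vector of the j-th dipole. *)
Definition data N (mu omega k : R) (y : 'I_N -> 'cV[R]_(2 + 1))
    (p : 'I_N -> 'cV[R[i]]_(2 + 1)) (u : R * R) : 'cV[R[i]]_(2 + 1) :=
  (mu * omega ^+ 2)%:C *:
    \sum_(j < N) dyadic_green (receiver u) (y j) k *m p j.

Definition kirchhoff N (mu omega k a : R) (y : 'I_N -> 'cV[R]_(2 + 1))
    (p : 'I_N -> 'cV[R[i]]_(2 + 1)) (x : 'cV[R]_(2 + 1)) :
    'cV[R[i]]_(2 + 1) :=
  ((mu * omega ^+ 2)^-1)%:C *:
    mxintegral (disk a) (fun u =>
      conj_mx (dyadic_green (receiver u) x k) *m data mu omega k y p u).

Definition psf (a k : R) (x x' : 'cV[R]_(2 + 1)) : 'M[R[i]]_(2 + 1) :=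
  mxintegral (disk a) (fun u =>
    conj_mx (dyadic_green (receiver u) x k) *m
    dyadic_green (receiver u) x' k).

(* min_{j in J} ||x - y_j||; the infimum is attained when J is nonempty. *)
Definition min_dist N (J : set 'I_N) (x : 'cV[R]_2) (y : 'I_N -> 'cV[R]_2) : R :=
  inf [set enorm (x - y j) | j in J].

(* The cross-talk term L / (a k min_{j in J} ||x - y_j||), absent (i.e. 0) when
   there is no index to minimize over. *)
Definition crosstalk N (J : set 'I_N) (L a k : R) (x : 'cV[R]_2)
    (y : 'I_N -> 'cV[R]_2) : R :=
  if J == set0 then 0 else L / (a * k * min_dist J x y).

(* (x, L + e) is in the imaging window: ||x|| = O(b) and |e| = O(h), with
   constants Cb and Ch. *)
Definition in_window (Cb Ch b h : R) (x : 'cV[R]_2) (e : R) : Prop :=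
  enorm x <= Cb * b /\ `|e| <= Ch * h.

End Imaging.

Section Regime.
Context {R : realType} {T : Type}.

(* X << Y along the filter F *)
Definition much_less (F : set_system T) (X Y : T -> R) : Prop :=
  (fun t => X t / Y t) @ F --> (0 : R).

(* The parameters vary with t : T along the filter F. *)
Record fraunhofer (F : set_system T) (k L a b h : T -> R) : Prop := {
  fr_kL : much_less F (fun=> 1) (fun t => k t * L t);
  fr_aL : much_less F a L;
  fr_bL : much_less F b L;
  fr_hL : much_less F h L;
  fr_Theta_b : much_less F (fun t => k t * b t ^+ 2 / L t) (fun=> 1);
  fr_Theta_a : much_less F (fun=> 1) (fun t => k t * a t ^+ 2 / L t);
  fr_Theta_aL : much_less F (fun t => k t * a t ^+ 2 / L t)
                            (fun t => L t ^+ 2 / a t ^+ 2);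
  fr_kh : exists M : R, \forall t \near F, `|k t * h t| <= M
}.

End Regime.

(* Main.v *)
(* Put eps = k a^4 / L^3 = a^2 Theta_a / L^2. Eventually b <= a, and
   Theta_a >= 1, k h = O(1) make 1/(k L), a^2/L^2 and h/L all O(eps). Expanding
   the distance gives, uniformly on the array,
     4 pi L G((u, 0), (y, z)) = exp(i (k z + k |u - y|^2 / (2 L))) M + O(eps),
   M = [[I, v/L], [v^T/L, 0]] with v = u - y. In conj(G) G' the phases quadratic
   in u cancel, so (4 pi L)^2 H_{1:2,1:3}(x, x') is, up to O(eps a^2), the
   Fourier transform over the disk of an affine amplitude, at the frequency
   xi = k (y - y') / L. If x = x', the 2x2 block is area(disk) I, and the range
   column is - area(disk) y / L by symmetry, whence the term b/L. If y <> y',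
   integrating along the coordinate in which xi is larger bounds the transform
   by O(a / |xi|) = O(a^2 L / (a k |y - y'|)), which is the cross-talk term. The
   2x2 system is thus a small perturbation of a scalar one. *)

Require Import Defs.
From HB Require Import structures.
From mathcomp Require Import all_boot all_order all_algebra.
From mathcomp Require Import all_classical all_reals all_analysis.
From mathcomp Require Import measurable_realfun complex ring lra.

Import Order.TTheory GRing.Theory Num.Theory.
Import numFieldNormedType.Exports.

Local Open Scope classical_set_scope.
Local Open Scope ring_scope.
Local Open Scope complex_scope.

(** The constant of the conclusion has to be chosen before the parameters and must serve every
    configuration in the window. The asymptotics are therefore traded for finitely many inequalities
    between [k], [L], [a], [b], [h] with explicit constants, and the filter is consulted only at the
    very end, to make these inequalities hold. A single [K] collects [Cb], [Ch] and the bound on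
    [k h]. The range offset is the delicate point: [k (z - L)] is bounded but not small. So [k z]
    stays exact in the phase, and [z] is replaced by [L] only in the Fresnel term, where the error
    [V k (L - z) / (2 z L)] gains the factor [V / L^2]. The amplitudes do not vanish on the rim of
    the disk, so a single integration by parts is made; its first-order decay is what the cross-talk
    term asks for. The inverse of the system matrix is never expanded. One a priori bound on
    solutions gives invertibility, and applied to [p] and to [p - p_i] it gives (ii) and (i). *)

Local Notation normc := Normc.normc.

(** * Modulus of complex numbers *)

Section ComplexModulus.
Context {R : realType}.
Implicit Types (z w : R[i]) (x y : R).

Lemma normc_ge0 z : 0 <= normc z.
Proof. by case: z => x y; exact: sqrtr_ge0. Qed.

Lemma normr_Re_le z : `|complex.Re z| <= normc z.
Proof.
case: z => x y /=; rewrite -sqrtr_sqr; apply: ler_wsqrtr.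
by rewrite lerDl sqr_ge0.
Qed.

Lemma normr_Im_le z : `|complex.Im z| <= normc z.
Proof.
case: z => x y /=; rewrite -sqrtr_sqr; apply: ler_wsqrtr.
by rewrite lerDr sqr_ge0.
Qed.

Lemma normc_le_ReIm z : normc z <= `|complex.Re z| + `|complex.Im z|.
Proof.
case: z => x y /=; rewrite -(@ger0_norm _ (`|x| + `|y|)) ?addr_ge0//.
rewrite -sqrtr_sqr; apply: ler_wsqrtr.
rewrite sqrrD !real_normK ?num_real// addrAC lerDl mulrn_wge0//.
Qed.

Lemma normc_real x : normc x%:C = `|x|.
Proof. by rewrite /= expr0n addr0 sqrtr_sqr. Qed.

Lemma normc_conj z : normc (z^*)%C = normc z.
Proof. by case: z => x y /=; rewrite sqrrN. Qed.

Lemma ler_normcB z w : normc (z - w) <= normc z + normc w.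
Proof. by rewrite -(normcN w); exact: le_normcD. Qed.

Lemma normc_sum (I : Type) (s : seq I) (P : pred I) (F : I -> R[i]) :
  normc (\sum_(i <- s | P i) F i) <= \sum_(i <- s | P i) normc (F i).
Proof.
elim/big_ind2: _ => [|x1 x2 y1 y2 h1 h2|//]; first by rewrite Normc.normc0.
by apply: (le_trans (le_normcD _ _)); exact: lerD.
Qed.

Lemma normc_i : normc ('i : R[i]) = 1.
Proof. by rewrite /= expr0n expr1n add0r sqrtr1. Qed.

Lemma normc_expi x : normc (expi x) = 1.
Proof. by rewrite /= cos2Dsin2 sqrtr1. Qed.

Lemma expiD x y : expi (x + y) = expi x * expi y.
Proof. by rewrite /expi cosD sinD; simpc; rewrite [X in _ +i* X]addrC. Qed.

Lemma conj_expi x : ((expi x)^*)%C = expi (- x).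
Proof. by rewrite /expi cosN sinN. Qed.

Lemma cos_lipschitz x y : `|cos x - cos y| <= `|x - y|.
Proof.
wlog xy : x y / x <= y => [hw|].
  by case: (leP x y) => [/hw//|/ltW/hw]; rewrite distrC (distrC y).
have [|c _] := @MVT_segment R cos (fun t => - sin t) x y xy.
  by apply: continuous_subspaceT; exact: continuous_cos.
rewrite distrC => ->; rewrite normrM distrC ler_piMl// normrN ler_norml.
by rewrite sin_geN1 sin_le1.
Qed.

(** Reduces every estimate on an imaginary part to the one on the real part, with a shifted
    phase. *)
Lemma sin_cos_shift x : sin x = cos (x - pi / 2).
Proof. by rewrite cosB cos_pihalf sin_pihalf mulr0 mulr1 add0r. Qed.

Lemma expi_lipschitz x y : normc (expi x - expi y) <= 2 * `|x - y|.
Proof.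
apply: (le_trans (normc_le_ReIm _)); rewrite /expi /= mulr_natl mulr2n.
apply: lerD; first exact: cos_lipschitz.
rewrite !sin_cos_shift; apply: (le_trans (cos_lipschitz _ _)).
by rewrite opprB addrA subrK.
Qed.

End ComplexModulus.

(** * Integration over the disk *)

Section DiskIntegral.
Context {R : realType}.
Local Notation mu := (@lebesgue_measure R).
Local Notation mu2 := (mu \x mu)%E.
Implicit Types (a : R) (f g : R * R -> R).

Lemma ord2_cases (i : 'I_2) : i = 0 \/ i = 1.
Proof. by case: i => [[|[|//]] hi]; [left|right]; apply/val_inj. Qed.

Lemma cvec0 (u : R * R) : cvec u 0 0 = u.1. Proof. by rewrite mxE. Qed.
Lemma cvec1 (u : R * R) : cvec u 1 0 = u.2. Proof. by rewrite mxE. Qed.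

Lemma enormE2 (v : 'cV[R]_2) : enorm v = Num.sqrt (v 0 0 ^+ 2 + v 1 0 ^+ 2).
Proof.
rewrite /enorm big_ord_recl big_ord1; congr (Num.sqrt (_ + v _ _ ^+ _)).
exact/val_inj.
Qed.

Lemma diskE a (u : R * R) : 0 <= a -> disk a u <-> u.1 ^+ 2 + u.2 ^+ 2 <= a ^+ 2.
Proof.
move=> a0; rewrite /disk /= enormE2 cvec0 cvec1.
by rewrite -[X in Num.sqrt _ <= X](ger0_norm a0) -sqrtr_sqr ler_sqrt ?sqr_ge0.
Qed.

Lemma measurable_disk a : measurable (disk a).
Proof.
rewrite [disk a](_ : _ = setT `&`
    (fun u : R * R => Num.sqrt (u.1 ^+ 2 + u.2 ^+ 2)) @^-1` `]-oo, a]); last first.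
  by apply/seteqP; split=> u /=; rewrite in_itv/= /disk /= enormE2 cvec0 cvec1; [|case].
suff : measurable_fun setT (fun u : R * R => Num.sqrt (u.1 ^+ 2 + u.2 ^+ 2)).
  by apply.
apply: measurableT_comp.
  by apply: continuous_measurable_fun; exact: sqrt_continuous.
by apply: measurable_funD; apply: measurable_funX.
Qed.

Lemma disk_subset_square a : 0 <= a ->
  disk a `<=` `[-a, a]%classic `*` `[-a, a]%classic.
Proof.
move=> a0 u /diskE => /(_ a0) h.
by split=> /=; rewrite in_itv/= -ler_norml -ler_sqr ?nnegrE// real_normK ?num_real//;
  nra.
Qed.

Lemma lebesgue_measure_itvNa a : 0 <= a ->
  mu (`[- a, a]%classic : set R) = (2 * a)%:E.
Proof.
move=> a0; rewrite lebesgue_measure_itv/= lte_fin.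
case: ifPn => [_|]; last rewrite -leNgt => ha.
  by rewrite -EFinD; congr EFin; ring.
have -> : a = 0 by lra.
by rewrite mulr0.
Qed.

Lemma mu2_square a : 0 <= a ->
  mu2 (`[-a, a]%classic `*` `[-a, a]%classic) = (4 * a ^+ 2)%:E.
Proof.
move=> a0; rewrite product_measure1E//= !lebesgue_measure_itvNa// -EFinM.
by congr EFin; ring.
Qed.

Lemma mu2_disk_lty a : 0 <= a -> (mu2 (disk a) < +oo)%E.
Proof.
move=> a0; apply: (@le_lt_trans _ _ (mu2 (`[-a, a]%classic `*` `[-a, a]%classic))).
  apply: le_measure; rewrite ?inE; [exact: measurable_disk| |exact: disk_subset_square].
  exact: measurableX.
by rewrite mu2_square// ltry.
Qed.

(** Only its order [a^2] matters, so the value [pi a^2] is never computed: squares of sides [a] and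
    [2 a], one inside and one around the disk, give the bounds. *)
Definition disk_area a : R := fine (mu2 (disk a)).

Lemma disk_area_le a : 0 <= a -> disk_area a <= 4 * a ^+ 2.
Proof.
move=> a0; rewrite -lee_fin fineK ?ge0_fin_numE ?mu2_disk_lty//.
rewrite -mu2_square//; apply: le_measure; rewrite ?inE.
- exact: measurable_disk.
- exact: measurableX.
- exact: disk_subset_square.
Qed.

Lemma disk_area_ge a : 0 <= a -> a ^+ 2 <= disk_area a.
Proof.
move=> a0; rewrite -lee_fin fineK ?ge0_fin_numE ?mu2_disk_lty//.
have -> : a ^+ 2 = 4 * (a / 2) ^+ 2 by field.
rewrite -mu2_square ?divr_ge0//; apply: le_measure; rewrite ?inE.
- exact: measurableX.
- exact: measurable_disk.
move=> u [] /=; rewrite !in_itv/= => /andP[h1 h2] /andP[h3 h4].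
by apply/diskE => //; nra.
Qed.

End DiskIntegral.

(** * Complex-valued integrals over the disk *)

Section ComplexIntegral.
Context {R : realType}.
Local Notation mu := (@lebesgue_measure R).
Local Notation mu2 := (mu \x mu)%E.
Implicit Types (a : R) (f g : R * R -> R[i]).

(** A class closed under sums, products and conjugation that guarantees integrability, the disk
    having finite measure. Measurability is asked on the whole plane so that compositions need no
    restriction; boundedness is asked on the disk only, since affine functions are unbounded. *)
Definition measurable_bounded a f : Prop :=
  [/\ measurable_fun setT (fun u => complex.Re (f u)),
      measurable_fun setT (fun u => complex.Im (f u)) &
      exists M, forall u, disk a u -> normc (f u) <= M].

Lemma disk_bounded_integrable a (f : R * R -> R) M : 0 <= a ->
  measurable_fun setT f -> (forall u, disk a u -> `|f u| <= M) ->
  mu2.-integrable (disk a) (EFin \o f).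
Proof.
move=> a0 mf fM; apply: measurable_bounded_integrable.
- exact: measurable_disk.
- exact: mu2_disk_lty.
- exact: measurable_funTS.
- exists M; split; first exact: num_real.
  by move=> x Mx u du; apply: (le_trans (fM _ du)); exact: ltW.
Qed.

Lemma integrable_Re {a f} : 0 <= a -> measurable_bounded a f ->
  mu2.-integrable (disk a) (EFin \o (fun u => complex.Re (f u))).
Proof.
move=> a0 [mr _ [M fM]]; apply: (@disk_bounded_integrable _ _ M) => // u du.
exact: (le_trans (normr_Re_le _) (fM _ du)).
Qed.

Lemma integrable_Im {a f} : 0 <= a -> measurable_bounded a f ->
  mu2.-integrable (disk a) (EFin \o (fun u => complex.Im (f u))).
Proof.
move=> a0 [_ mi [M fM]]; apply: (@disk_bounded_integrable _ _ M) => // u du.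
exact: (le_trans (normr_Im_le _) (fM _ du)).
Qed.

Lemma measurable_bounded_cst a (c : R[i]) : measurable_bounded a (fun=> c).
Proof. by split; [exact: measurable_cst|exact: measurable_cst|exists (normc c)]. Qed.

Lemma measurable_bounded_real a (f : R * R -> R) M :
  measurable_fun setT f -> (forall u, disk a u -> `|f u| <= M) ->
  measurable_bounded a (fun u => (f u)%:C).
Proof.
move=> mf fM; split; [exact: mf|exact: measurable_cst|].
by exists M => u du; rewrite normc_real; exact: fM.
Qed.

Lemma measurable_boundedD a f g : measurable_bounded a f ->
  measurable_bounded a g -> measurable_bounded a (fun u => f u + g u).
Proof.
move=> [fr fi [M fM]] [gr gi [M' gM]]; split.
- rewrite [X in measurable_fun _ X](_ : _ =
    (fun u => complex.Re (f u)) \+ (fun u => complex.Re (g u))).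
    exact: measurable_funD.
  by apply/funext => u /=; rewrite raddfD.
- rewrite [X in measurable_fun _ X](_ : _ =
    (fun u => complex.Im (f u)) \+ (fun u => complex.Im (g u))).
    exact: measurable_funD.
  by apply/funext => u /=; rewrite raddfD.
- exists (M + M') => u du; apply: (le_trans (le_normcD _ _)).
  by rewrite lerD ?fM ?gM.
Qed.

Lemma measurable_boundedM a f g : measurable_bounded a f ->
  measurable_bounded a g -> measurable_bounded a (fun u => f u * g u).
Proof.
move=> [fr fi [M fM]] [gr gi [M' gM]]; split.
- rewrite [X in measurable_fun _ X](_ : _ =
    ((fun u => complex.Re (f u)) \* (fun u => complex.Re (g u))) \-
    ((fun u => complex.Im (f u)) \* (fun u => complex.Im (g u)))).
    by apply: measurable_funB; exact: measurable_funM.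
  by apply/funext => u /=; case: (f u) (g u) => ? ? [].
- rewrite [X in measurable_fun _ X](_ : _ =
    ((fun u => complex.Re (f u)) \* (fun u => complex.Im (g u))) \+
    ((fun u => complex.Im (f u)) \* (fun u => complex.Re (g u)))).
    by apply: measurable_funD; exact: measurable_funM.
  by apply/funext => u /=; case: (f u) (g u) => ? ? [].
- exists (M * M') => u du; rewrite Normc.normcM.
  by rewrite ler_pM ?normc_ge0 ?fM ?gM.
Qed.

Lemma measurable_boundedN a f :
  measurable_bounded a f -> measurable_bounded a (fun u => - f u).
Proof.
move=> mf; rewrite [X in measurable_bounded _ X](_ : _ = fun u => -1 * f u).
  by apply: measurable_boundedM => //; exact: measurable_bounded_cst.
by apply/funext => u; rewrite mulN1r.
Qed.

Lemma measurable_bounded_conj a f :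
  measurable_bounded a f -> measurable_bounded a (fun u => ((f u)^*)%C).
Proof.
move=> [fr fi [M fM]]; split.
- rewrite [X in measurable_fun _ X](_ : _ = (fun u => complex.Re (f u)))//.
  by apply/funext => u /=; case: (f u).
- rewrite [X in measurable_fun _ X](_ : _ = \- (fun u => complex.Im (f u))).
    exact: measurable_funN.
  by apply/funext => u /=; case: (f u).
- by exists M => u du; rewrite normc_conj; exact: fM.
Qed.

Lemma measurable_bounded_sum a n (F : 'I_n -> R * R -> R[i]) :
  (forall i, measurable_bounded a (F i)) ->
  measurable_bounded a (fun u => \sum_(i < n) F i u).
Proof.
elim: n F => [|n ih] F mF.
  under eq_fun do rewrite big_ord0; exact: measurable_bounded_cst.
under eq_fun do rewrite big_ord_recr; apply: measurable_boundedD => //.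
exact: ih.
Qed.

Lemma CintegralD a f g : 0 <= a ->
  measurable_bounded a f -> measurable_bounded a g ->
  Cintegral (disk a) (fun u => f u + g u) =
  Cintegral (disk a) f + Cintegral (disk a) g.
Proof.
move=> a0 mf mg; rewrite /Cintegral; simpc; congr (_ +i* _).
- rewrite -RintegralD//;
    [|exact: measurable_disk|exact: integrable_Re|exact: integrable_Re].
  by congr Rintegral; apply/funext => u; rewrite raddfD.
- rewrite -RintegralD//;
    [|exact: measurable_disk|exact: integrable_Im|exact: integrable_Im].
  by congr Rintegral; apply/funext => u; rewrite raddfD.
Qed.

Lemma CintegralZl a (c : R[i]) f : 0 <= a -> measurable_bounded a f ->
  Cintegral (disk a) (fun u => c * f u) = c * Cintegral (disk a) f.
Proof.
move=> a0 mf; case: c => x y.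
have mD := @measurable_disk R a.
have [fr fi [M fM]] := mf.
have iZ z : mu2.-integrable (disk a) (EFin \o (fun u => z * complex.Re (f u))).
  apply: (@disk_bounded_integrable _ _ (`|z| * M)) => //.
    by apply: measurable_funM.
  move=> u du; rewrite normrM ler_wpM2l//.
  exact: (le_trans (normr_Re_le _) (fM _ du)).
have iZ' z : mu2.-integrable (disk a) (EFin \o (fun u => z * complex.Im (f u))).
  apply: (@disk_bounded_integrable _ _ (`|z| * M)) => //.
    by apply: measurable_funM.
  move=> u du; rewrite normrM ler_wpM2l//.
  exact: (le_trans (normr_Im_le _) (fM _ du)).
rewrite /Cintegral; simpc; congr (_ +i* _).
- rewrite -!RintegralZl//; [|exact: integrable_Im|exact: integrable_Re].
  rewrite -RintegralB//.
  by congr Rintegral; apply/funext => u; case: (f u).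
- rewrite -!RintegralZl//; [|exact: integrable_Re|exact: integrable_Im].
  rewrite -RintegralD//.
  by congr Rintegral; apply/funext => u; case: (f u).
Qed.

Lemma Cintegral_cst a (c : R[i]) : 0 <= a ->
  Cintegral (disk a) (fun=> c) = c * (disk_area a)%:C.
Proof.
case: c => x y a0; rewrite /Cintegral !Rintegral_cst; try exact: measurable_disk.
by simpc.
Qed.

Lemma Cintegral_sum a n (F : 'I_n -> R * R -> R[i]) : 0 <= a ->
  (forall i, measurable_bounded a (F i)) ->
  Cintegral (disk a) (fun u => \sum_(i < n) F i u) =
  \sum_(i < n) Cintegral (disk a) (F i).
Proof.
move=> a0; elim: n F => [|n ih] F mF.
  by under eq_fun do rewrite big_ord0; rewrite Cintegral_cst// mul0r big_ord0.
under eq_fun do rewrite big_ord_recr.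
rewrite CintegralD//; last exact: measurable_bounded_sum.
by rewrite big_ord_recr ih.
Qed.

Lemma disk_integral_bound a (f : R * R -> R) M : 0 <= a -> 0 <= M ->
  measurable_fun setT f -> (forall u, disk a u -> `|f u| <= M) ->
  `|\int[mu2]_(u in disk a) f u| <= M * (4 * a ^+ 2).
Proof.
move=> a0 M0 mf fM; have intf := disk_bounded_integrable _ _ _ a0 mf fM.
apply: (le_trans (le_normr_Rintegral _ intf)); first exact: measurable_disk.
apply: (@le_trans _ _ (\int[mu2]_(u in disk a) M)).
  apply: le_Rintegral => //; [exact: measurable_disk|exact: integrable_norm|].
  by apply: (@disk_bounded_integrable _ _ M) => // u _; rewrite ger0_norm.
by rewrite Rintegral_cst ?ler_wpM2l ?disk_area_le//; exact: measurable_disk.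
Qed.

(** The 8 is twice 4: real and imaginary parts are bounded separately, each through the area [4 a^2]
    of the enclosing square. *)
Lemma Cintegral_bound a f M : 0 <= a -> 0 <= M -> measurable_bounded a f ->
  (forall u, disk a u -> normc (f u) <= M) ->
  normc (Cintegral (disk a) f) <= 8 * M * a ^+ 2.
Proof.
move=> a0 M0 [fr fi _] fM; apply: (le_trans (normc_le_ReIm _)).
rewrite (_ : 8 * M * a ^+ 2 = M * (4 * a ^+ 2) + M * (4 * a ^+ 2)); last by ring.
apply: lerD; apply: disk_integral_bound => // u du.
- exact: (le_trans (normr_Re_le _) (fM _ du)).
- exact: (le_trans (normr_Im_le _) (fM _ du)).
Qed.

End ComplexIntegral.

(** * Fourier integrals over the disk *)

Section OscillatoryIntegrals.
Context {R : realType}.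
Local Notation mu := (@lebesgue_measure R).
Local Notation mu2 := (mu \x mu)%E.

(** The degenerate interval is included because the chord of the disk at height [|t| = a] is a
    single point. *)
Lemma integral_itv_derive (F f : R -> R) (x y : R) : x <= y ->
  (forall s : R, is_derive s 1 F (f s)) -> continuous f ->
  (\int[mu]_(s in `[x, y]) (f s)%:E = (F y - F x)%:E)%E.
Proof.
rewrite le_eqVlt => /predU1P[-> _ _|xy dF cf].
  by rewrite set_itv1 integral_set1 subrr.
have cF : continuous F.
  by move=> s; apply/differentiable_continuous/derivable1_diffP; case: (dF s).
rewrite (@continuous_FTC2 _ f F)//.
- exact: continuous_subspaceT.
- split=> [s _||]; first by case: (dF s).
    exact/cvg_at_right_filter/cF.
  exact/cvg_at_left_filter/cF.
- by move=> s _; rewrite derive1E; exact: derive_val.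
Qed.

Lemma is_derive_mul (f g : R -> R) (s df dg : R) :
  is_derive s 1 f df -> is_derive s 1 g dg ->
  is_derive s 1 (fun t => f t * g t) (f s * dg + g s * df).
Proof. by move=> hf hg; exact: is_deriveM hf hg. Qed.

Lemma is_derive_affine (x c s : R) : is_derive s 1 (fun t : R => c + x * t) x.
Proof.
have h : is_derive s 1 (fun t : R => x * t) (x * 1 + s * 0).
  by apply: is_derive_mul; exact: is_derive_cst || exact: is_derive_id.
have h' := is_deriveD (is_derive_cst c s 1) h.
by apply: (is_derive_eq h'); rewrite mulr0 addr0 add0r mulr1.
Qed.

(** One integration by parts, made exact by the antiderivative [F]: the amplitude is affine, so the
    remaining integral is explicit too. *)
Lemma oscillatory_integral (p q x c w : R) : x != 0 -> 0 <= w ->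
  (`|\int[mu]_(s in `[(- w)%R, w]) ((p + q * s) * cos (c + x * s))%:E|
     <= (2 / `|x| * (`|p| + 2 * (`|q| * w)))%:E)%E.
Proof.
move=> x0 w0.
pose F s :=
  (p + q * s) * (sin (c + x * s) * x^-1) + cos (c + x * s) * (q / x ^+ 2).
have hF (s : R) : is_derive s 1 F ((p + q * s) * cos (c + x * s)).
  have d1 := is_derive_affine q p s.
  have d2 := is_derive_affine x c s.
  have d3 : is_derive s 1 (fun t => sin (c + x * t)) (cos (c + x * s) * x).
    exact: (is_derive1_comp (is_derive_sin _) d2).
  have d4 : is_derive s 1 (fun t => cos (c + x * t)) (- sin (c + x * s) * x).
    exact: (is_derive1_comp (is_derive_cos _) d2).
  have d5 := is_derive_mul _ _ _ _ _ d1
    (is_derive_mul _ _ _ _ _ d3 (is_derive_cst x^-1 s 1)).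
  have d6 := is_derive_mul _ _ _ _ _ d4 (is_derive_cst (q / x ^+ 2) s 1).
  apply: (is_derive_eq (is_deriveD d5 d6)).
  by rewrite /cst; field.
have hc : continuous (fun s : R => (p + q * s) * cos (c + x * s)).
  have ca (y z : R) : continuous (fun s : R => y + z * s).
    move=> s; apply: cvgD; first exact: cvg_cst.
    by apply: cvgM; [exact: cvg_cst|exact: cvg_id].
  move=> s; apply: cvgM; first exact: ca.
  apply: (@continuous_comp _ _ _ (fun s => c + x * s) cos); first exact: ca.
  exact: continuous_cos.
have ww : - w <= w by rewrite ge0_cp.
rewrite (integral_itv_derive _ _ _ _ ww hF hc).
have n0 : 0 < `|x| by rewrite normr_gt0.
have hs (y : R) : `|sin y| <= 1 by rewrite ler_norml sin_geN1 sin_le1.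
rewrite lee_fin /F.
have b1 s : `|s| = w ->
    `|(p + q * s) * (sin (c + x * s) / x)| <= (`|p| + `|q| * w) / `|x|.
  move=> sw; rewrite normrM normf_div mulrA ler_pM2r ?invr_gt0//.
  rewrite -[X in _ <= X]mulr1 ler_pM//.
  by apply: (le_trans (ler_normD _ _)); rewrite normrM sw.
have nw : `|w| = w by rewrite ger0_norm.
have b2 := b1 w nw; have b3 := b1 (- w) (etrans (normrN w) nw).
(* The Lipschitz bound on the difference of cosines cancels one power of [x]. The bound by 2 would
   leave [|q| / x^2], which is too large when [|x| w] is small. *)
have b4 : `|(cos (c + x * w) - cos (c + x * - w)) * (q / x ^+ 2)|
    <= 2 * (`|q| * w) / `|x|.
  rewrite normrM normf_div normrX.
  rewrite (_ : 2 * _ / _ = (2 * (`|x| * w)) * (`|q| / `|x| ^+ 2)); last first.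
    by field; rewrite normr_eq0.
  apply: ler_wpM2r; first by rewrite divr_ge0 ?sqr_ge0.
  apply: (le_trans (cos_lipschitz _ _)).
  rewrite (_ : _ - _ = 2 * (x * w)); last by ring.
  by rewrite !normrM nw ger0_norm.
set A := (p + q * w) * _ in b2 *; set B := (p + q * - w) * _ in b3 *.
rewrite (_ : A + _ - _ =
  A - B + (cos (c + x * w) - cos (c + x * - w)) * (q / x ^+ 2)); last by ring.
apply: (le_trans (ler_normD _ _)); apply: (le_trans (lerD (ler_normB _ _) b4)).
apply: (le_trans (lerD (lerD b2 b3) (lexx _))).
rewrite le_eqVlt; apply/orP; left; apply/eqP; field; rewrite normr_eq0//.
Qed.

End OscillatoryIntegrals.

(** * Iterated integrals and chords of the disk *)

Section Fubini.
Context {R : realType}.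
Local Notation mu := (@lebesgue_measure R).
Local Notation mu2 := (mu \x mu)%E.
Variables (a : R) (f : R * R -> R) (M : R).
Hypotheses (a0 : 0 <= a) (mf : measurable_fun setT f)
  (fM : forall u, disk a u -> `|f u| <= M).

Let F : R * R -> \bar R := EFin \o (f \_ (disk a)).

Let intF : mu2.-integrable setT F.
Proof.
rewrite /F -restrict_EFin.
have h := disk_bounded_integrable _ _ _ a0 mf fM.
refine ((@integrable_mkcond _ _ _ mu2 (disk a) (EFin \o f) _).1 h).
exact: measurable_disk.
Qed.

Lemma disk_integral_iterate1 :
  (\int[mu2]_(u in disk a) (f u)%:E = \int[mu]_t \int[mu]_s F (s, t))%E.
Proof.
rewrite integral_mkcond.
have -> : (fun u => (f u)%:E) \_ (disk a) = F by rewrite /F -restrict_EFin.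
by rewrite -(integral21_prod_meas1 intF).
Qed.

Lemma disk_integral_iterate2 :
  (\int[mu2]_(u in disk a) (f u)%:E = \int[mu]_s \int[mu]_t F (s, t))%E.
Proof.
rewrite integral_mkcond.
have -> : (fun u => (f u)%:E) \_ (disk a) = F by rewrite /F -restrict_EFin.
by rewrite -(integral12_prod_meas1 intF).
Qed.

Lemma disk_section (t : R) :
  (\int[mu]_s F (s, t) = if (`|t| <= a)%R then
    \int[mu]_(s in `[(- Num.sqrt (a ^+ 2 - t ^+ 2))%R,
                     (Num.sqrt (a ^+ 2 - t ^+ 2))%R]) (f (s, t))%:E
    else 0)%E.
Proof.
have key s : disk a (s, t) <-> s ^+ 2 <= a ^+ 2 - t ^+ 2.
  by rewrite diskE//= -lerBrDr.
case: ifPn => ta.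
  rewrite [RHS]integral_mkcond; apply: eq_integral => s _.
  rewrite /F /= /patch.
  have h : 0 <= a ^+ 2 - t ^+ 2.
    by rewrite subr_ge0 -(real_normK (num_real t)) lerXn2r ?nnegrE.
  have -> : ((s, t) \in disk a) =
     (s \in [set` `[- Num.sqrt (a ^+ 2 - t ^+ 2), Num.sqrt (a ^+ 2 - t ^+ 2)]]).
    apply/idP/idP; rewrite !inE /= in_itv/= -ler_norml => h1.
      by rewrite -sqrtr_sqr ler_wsqrtr//; apply/key.
    by apply/key; move: h1; rewrite -sqrtr_sqr ler_sqrt.
  by case: ifP.
rewrite integral0_eq// => s _; rewrite /F /= /patch ifF//.
apply/negP; rewrite inE => /key h; move: ta; rewrite -ltNge => ta.
have : a ^+ 2 < t ^+ 2.
  by rewrite -(real_normK (num_real t)) ltrXn2r ?nnegrE.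
have := sqr_ge0 s; lra.
Qed.

(** The heights of the chords fill an interval of length [2 a]. A uniform one-dimensional estimate
    thus becomes a two-dimensional one; [B = 0] is allowed and serves the first moments. *)
Lemma disk_integral_section_bound B : 0 <= B ->
  (forall t, `|t| <= a ->
    (`|\int[mu]_(s in `[(- Num.sqrt (a ^+ 2 - t ^+ 2))%R,
                      (Num.sqrt (a ^+ 2 - t ^+ 2))%R]) (f (s, t))%:E|
     <= B%:E)%E) ->
  `|\int[mu2]_(u in disk a) f u| <= 2 * a * B.
Proof.
move=> B0 hB.
have h := disk_bounded_integrable _ _ _ a0 mf fM.
have := EFin_normr_Rintegral _ h.
move=> /(_ (measurable_disk _)) => hE.
rewrite -lee_fin hE disk_integral_iterate1.
pose G t := (\int[mu]_s F (s, t))%E.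
have mG : measurable_fun setT G by exact: (measurable_fubini_G intF).
have -> : (\int[mu]_t \int[mu]_s F (s, t) = \int[mu]_(t in `[(- a)%R, a]) G t)%E.
  rewrite [RHS]integral_mkcond; apply: eq_integral => t _.
  rewrite /patch mem_setE in_itv/= -ler_norml; case: ifPn => // ta.
  by rewrite disk_section (negbTE ta).
have mI : measurable (`[(- a)%R, a]%classic : set R) by [].
apply: (le_trans (le_abse_integral mu mI (measurable_funTS mG))).
have -> : ((2 * a * B)%:E = B%:E * mu `[(- a)%R, a])%E.
  by rewrite lebesgue_measure_itvNa// -EFinM mulrC.
apply: integral_le_bound => //; first exact: measurable_funTS.
apply: aeW => t /=; rewrite in_itv/= -ler_norml => ta.
by rewrite /G disk_section ta; exact: hB.
Qed.

End Fubini.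

(** * Fourier transforms of affine amplitudes, and moments of the disk *)

Section DiskFourier.
Context {R : realType}.
Local Notation mu := (@lebesgue_measure R).
Local Notation mu2 := (mu \x mu)%E.

(** The two orders of integration in Fubini's theorem are exchanged by the reflection of the disk in
    its diagonal. This makes the choice of the coordinate of integration free. *)
Lemma disk_integral_swap (a : R) (f : R * R -> R) M : 0 <= a ->
  measurable_fun setT f -> (forall u, disk a u -> `|f u| <= M) ->
  \int[mu2]_(u in disk a) f u = \int[mu2]_(u in disk a) f (u.2, u.1).
Proof.
move=> a0 mf fM.
have dC u : disk a (u.2, u.1) <-> disk a u by rewrite !diskE//= addrC.
have mg : measurable_fun setT (fun u : R * R => f (u.2, u.1)).
  by apply: (measurableT_comp mf); exact: measurable_swap.
have gM u : disk a u -> `|f (u.2, u.1)| <= M by move/dC; exact: fM.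
rewrite /Rintegral; congr fine.
rewrite (disk_integral_iterate1 _ _ _ a0 mf fM).
rewrite (disk_integral_iterate2 _ _ _ a0 mg gM).
apply: eq_integral => t _; apply: eq_integral => s _ /=; rewrite /patch.
congr (EFin (if _ then _ else _)).
by apply/idP/idP; rewrite !inE => h; apply/dC.
Qed.

(** Serves both as amplitude and as phase: a leading-order integrand is one [affine2] times [expi]
    of another. *)
Definition affine2 (p q1 q2 : R) (u : R * R) : R := p + q1 * u.1 + q2 * u.2.

Lemma measurable_affine2 p q1 q2 : measurable_fun setT (affine2 p q1 q2).
Proof.
by apply: measurable_funD; [apply: measurable_funD => //|]; apply: measurable_funM.
Qed.

Lemma disk_coord_le (a : R) u : 0 <= a -> disk a u -> `|u.1| <= a /\ `|u.2| <= a.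
Proof.
move=> a0 /(disk_subset_square _ a0)[/=]; rewrite !in_itv/= => h1 h2.
by rewrite !ler_norml.
Qed.

Lemma affine2_bound p q1 q2 (a : R) u : 0 <= a -> disk a u ->
  `|affine2 p q1 q2 u| <= `|p| + a * (`|q1| + `|q2|).
Proof.
move=> a0 /(disk_coord_le _ _ a0)[h1 h2].
apply: (le_trans (ler_normD _ _)); rewrite mulrDr addrA lerD//.
  apply: (le_trans (ler_normD _ _)); rewrite lerD// normrM mulrC.
  exact: ler_wpM2r.
by rewrite normrM mulrC; exact: ler_wpM2r.
Qed.

Lemma measurable_cos_affine2 p q1 q2 :
  measurable_fun setT (fun u => cos (affine2 p q1 q2 u)).
Proof.
apply: measurableT_comp (measurable_affine2 _ _ _).
by apply: continuous_measurable_fun; exact: continuous_cos.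
Qed.

Lemma normr_cos_le1 (x : R) : `|cos x| <= 1.
Proof. by rewrite ler_norml cos_geN1 cos_le1. Qed.

(* The phase is integrated along u.1 only, at fixed u.2. *)
Lemma disk_oscillatory1 (a p q1 q2 c x1 x2 : R) : 0 <= a -> x1 != 0 ->
  `|\int[mu2]_(u in disk a) (affine2 p q1 q2 u * cos (affine2 c x1 x2 u))|
    <= 4 * a / `|x1| * (`|p| + 2 * (a * (`|q1| + `|q2|))).
Proof.
move=> a0 x10.
have n0 : 0 < `|x1| by rewrite normr_gt0.
have -> : 4 * a / `|x1| * (`|p| + 2 * (a * (`|q1| + `|q2|))) =
  2 * a * (2 / `|x1| * (`|p| + 2 * (a * (`|q1| + `|q2|)))).
  by field; rewrite normr_eq0.
have aq : 0 <= a * (`|q1| + `|q2|) by rewrite mulr_ge0 ?addr_ge0.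
apply: (@disk_integral_section_bound _ _ _ (`|p| + a * (`|q1| + `|q2|))) => //.
- exact: measurable_funM (measurable_affine2 _ _ _) (measurable_cos_affine2 _ _ _).
- move=> u du; rewrite normrM -[X in _ <= X]mulr1 ler_pM//.
    exact: affine2_bound.
  exact: normr_cos_le1.
- by rewrite mulr_ge0 ?divr_ge0 ?addr_ge0// mulr_ge0.
- move=> t ta; set w := Num.sqrt _.
  have w0 : 0 <= w by exact: sqrtr_ge0.
  have wa : w <= a.
    rewrite -[X in _ <= X]ger0_norm// -sqrtr_sqr ler_wsqrtr//.
    by rewrite gerBl sqr_ge0.
  rewrite (@eq_integral _ _ _ mu _ (fun s =>
    (((p + q2 * t) + q1 * s) * cos ((c + x2 * t) + x1 * s))%:E)); last first.
    by move=> s _; rewrite /affine2/=; congr (_ * cos _)%:E; ring.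
  apply: (le_trans (oscillatory_integral _ _ _ _ _ x10 w0)).
  rewrite lee_fin; apply: ler_wpM2l; first by rewrite divr_ge0.
  have h1 : `|p + q2 * t| <= `|p| + `|q2| * a.
    by apply: (le_trans (ler_normD _ _)); rewrite normrM lerD// ler_wpM2l.
  have h2 : `|q1| * w <= `|q1| * a by rewrite ler_wpM2l.
  have h3 : 0 <= a * `|q2| by rewrite mulr_ge0.
  nra.
Qed.

Lemma disk_oscillatory (a p q1 q2 c x1 x2 : R) : 0 <= a ->
  0 < Num.sqrt (x1 ^+ 2 + x2 ^+ 2) ->
  `|\int[mu2]_(u in disk a) (affine2 p q1 q2 u * cos (affine2 c x1 x2 u))|
    <= 8 * a / Num.sqrt (x1 ^+ 2 + x2 ^+ 2) * (`|p| + 2 * (a * (`|q1| + `|q2|))).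
Proof.
move=> a0.
wlog : q1 q2 x1 x2 / `|x2| <= `|x1| => [hw n0|x21 n0].
  have [/hw|/ltW x12] := leP `|x2| `|x1|; first exact.
  have n0' : 0 < Num.sqrt (x2 ^+ 2 + x1 ^+ 2) by rewrite addrC.
  have := hw q2 q1 x2 x1 x12 n0'.
  rewrite [x2 ^+ 2 + _]addrC [`|q2| + _]addrC; apply: le_trans.
  rewrite (@disk_integral_swap _ _ (`|p| + a * (`|q1| + `|q2|)))//.
  - rewrite le_eqVlt; apply/orP; left; apply/eqP; congr `|_|.
    by apply: eq_Rintegral => u _; rewrite /affine2/=; congr (_ * cos _); ring.
  - exact: measurable_funM (measurable_affine2 _ _ _) (measurable_cos_affine2 _ _ _).
  - move=> u du; rewrite normrM -[X in _ <= X]mulr1 ler_pM//.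
      exact: affine2_bound.
    exact: normr_cos_le1.
set n := Num.sqrt _ in n0 *.
(* The larger coordinate carries at least half of the norm; this doubles the 4 of the one-coordinate
   bound to 8. *)
have hn : n <= 2 * `|x1|.
  rewrite -[X in _ <= X]ger0_norm ?mulr_ge0// -sqrtr_sqr ler_wsqrtr// exprMn.
  rewrite -(real_normK (num_real x1)) -(real_normK (num_real x2)).
  have := normr_ge0 x2; nra.
have x10 : 0 < `|x1| by lra.
apply: (le_trans (disk_oscillatory1 _ _ _ _ _ _ _ a0 _)); first by rewrite -normr_gt0.
apply: ler_wpM2r; first by rewrite addr_ge0// mulr_ge0// mulr_ge0// addr_ge0.
rewrite ler_pdivrMr// mulrAC ler_pdivlMr//; nra.
Qed.

Lemma measurable_bounded_affine2_expi (a p q1 q2 c x1 x2 : R) : 0 <= a ->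
  measurable_bounded a
    (fun u => (affine2 p q1 q2 u)%:C * expi (affine2 c x1 x2 u)).
Proof.
move=> a0; apply: measurable_boundedM.
  apply: (@measurable_bounded_real _ _ _ (`|p| + a * (`|q1| + `|q2|))).
    exact: measurable_affine2.
  by move=> u du; exact: affine2_bound.
split; first exact: measurable_cos_affine2.
  apply: measurableT_comp (measurable_affine2 _ _ _).
  by apply: continuous_measurable_fun; exact: continuous_sin.
by exists 1 => u _; rewrite normc_expi.
Qed.

Lemma disk_fourier (a p q1 q2 c x1 x2 : R) : 0 <= a ->
  0 < Num.sqrt (x1 ^+ 2 + x2 ^+ 2) ->
  normc (Cintegral (disk a)
          (fun u => (affine2 p q1 q2 u)%:C * expi (affine2 c x1 x2 u)))
    <= 16 * a / Num.sqrt (x1 ^+ 2 + x2 ^+ 2) * (`|p| + 2 * (a * (`|q1| + `|q2|))).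
Proof.
move=> a0 n0; apply: (le_trans (normc_le_ReIm _)).
set n := Num.sqrt _ in n0 *.
rewrite (_ : 16 * a / n * _ =
  8 * a / n * (`|p| + 2 * (a * (`|q1| + `|q2|))) +
  8 * a / n * (`|p| + 2 * (a * (`|q1| + `|q2|)))); last by field; rewrite gt_eqF.
apply: lerD; rewrite /Cintegral /=.
  apply: (le_trans _ (disk_oscillatory a p q1 q2 c x1 x2 a0 n0)).
  rewrite le_eqVlt; apply/orP; left; apply/eqP; congr `|_|.
  by apply: eq_Rintegral => u _; rewrite mul0r subr0.
(* The bound does not see the constant part of the phase, so the sine costs the same as the cosine;
   together they turn 8 into 16. *)
apply: (le_trans _ (disk_oscillatory a p q1 q2 (c - pi / 2) x1 x2 a0 n0)).
rewrite le_eqVlt; apply/orP; left; apply/eqP; congr `|_|.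
apply: eq_Rintegral => u _; rewrite mul0r addr0 sin_cos_shift.
by rewrite /affine2; congr (_ * cos _); ring.
Qed.

(** Each chord is symmetric about 0 and the antiderivative [s^2 / 2] is even, so every section
    contributes 0. *)
Lemma disk_integral_fst (a : R) : 0 <= a -> \int[mu2]_(u in disk a) u.1 = 0.
Proof.
move=> a0; apply/eqP; rewrite -normr_le0 -(mulr0 (2 * a)).
apply: (@disk_integral_section_bound _ _ _ a) => //.
  by move=> u /(disk_coord_le _ _ a0)[].
move=> t ta; set w := Num.sqrt _.
have w0 : - w <= w by rewrite ge0_cp// sqrtr_ge0.
have dF (s : R) : is_derive s 1 (fun t : R => 2^-1 * (t * t)) s.
  have h : is_derive s 1 (fun t : R => t * t) (s * 1 + s * 1).
    by apply: is_derive_mul; exact: is_derive_id.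
  have h' := is_derive_mul _ _ _ _ _ (is_derive_cst (2^-1 : R) s 1) h.
  by apply: (is_derive_eq h'); rewrite /cst; field.
have cI : continuous (fun s : R => s) by move=> s; exact: cvg_id.
by rewrite (integral_itv_derive _ _ _ _ w0 dF cI) lee_fin mulrNN subrr normr0.
Qed.

Lemma disk_integral_snd (a : R) : 0 <= a -> \int[mu2]_(u in disk a) u.2 = 0.
Proof.
move=> a0; rewrite -(disk_integral_fst _ a0).
rewrite [RHS](@disk_integral_swap _ _ a)//.
by move=> u /(disk_coord_le _ _ a0)[].
Qed.

(** The vanishing first moments are what leaves [b / L], rather than [a / L], in the range column of
    the diagonal response. *)
Lemma Cintegral_affine2 (a p q1 q2 : R) : 0 <= a ->
  Cintegral (disk a) (fun u => (affine2 p q1 q2 u)%:C) = (p * disk_area a)%:C.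
Proof.
move=> a0; rewrite /Cintegral /=.
have i1 q : mu2.-integrable (disk a) (EFin \o (fun u => q * u.1)).
  apply: (@disk_bounded_integrable _ _ _ (`|q| * a)) => //.
    exact: measurable_funM.
  by move=> u /(disk_coord_le _ _ a0)[h _]; rewrite normrM ler_wpM2l.
have i2 q : mu2.-integrable (disk a) (EFin \o (fun u => q * u.2)).
  apply: (@disk_bounded_integrable _ _ _ (`|q| * a)) => //.
    exact: measurable_funM.
  by move=> u /(disk_coord_le _ _ a0)[_ h]; rewrite normrM ler_wpM2l.
have i0 : mu2.-integrable (disk a) (EFin \o (fun=> p)).
  by apply: (@disk_bounded_integrable _ _ _ `|p|).
have iF : mu2.-integrable (disk a) (EFin \o (fst : R * R -> R)).
  by apply: (@disk_bounded_integrable _ _ _ a) => // u /(disk_coord_le _ _ a0)[].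
have iS : mu2.-integrable (disk a) (EFin \o (snd : R * R -> R)).
  by apply: (@disk_bounded_integrable _ _ _ a) => // u /(disk_coord_le _ _ a0)[].
congr (_ +i* _).
  rewrite /affine2 RintegralD//; [|exact: measurable_disk|].
    rewrite RintegralD//; [|exact: measurable_disk].
    rewrite !RintegralZl//; try exact: measurable_disk.
    rewrite disk_integral_fst// disk_integral_snd// !mulr0 !addr0.
    by rewrite Rintegral_cst//; exact: measurable_disk.
  apply: (@disk_bounded_integrable _ _ _ (`|p| + a * (`|q1| + `|0|))) => //.
    by apply: measurable_funD => //; apply: measurable_funM.
  move=> u du; have := affine2_bound p q1 0 a u a0 du.
  by rewrite /affine2 mul0r addr0; exact: le_trans.
by rewrite Rintegral_cst ?mul0r//; exact: measurable_disk.
Qed.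

End DiskFourier.

(** * Far field of the dyadic Green function *)

(* z is the range of the imaging point, V the squared cross-range distance from
   the receiver to it, and K collects the O-constants of the window. L <= k a^2
   is Theta_a >= 1. *)
Record far_field {R : realType} (k L a K z V : R) : Prop := {
  ff_k : 0 < k; ff_L : 0 < L; ff_a : 0 < a; ff_K : 1 <= K;
  ff_kL : 2 <= k * L; ff_Lka : L <= k * a ^+ 2; ff_KaL : K * a <= L;
  ff_zL : `|z - L| <= L / 2; ff_kzL : k * `|z - L| <= K;
  ff_V0 : 0 <= V; ff_VK : V <= (K * a) ^+ 2 }.

Section FarFieldScalars.
Context {R : realType} {k L a K z V : R}.
Hypothesis H : far_field k L a K z V.

Let eps := k * a ^+ 4 / L ^+ 3.
Let r := Num.sqrt (V + z ^+ 2).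

(** The product is the square of [Theta_a], and in [eps_a2] the quotient of [eps] by [a^2 / L^2] is
    [Theta_a] itself; both are controlled by [L <= k a^2]. *)
Lemma eps_kL : 1 <= eps * (k * L).
Proof.
have [k0 L0 a0 K1 kL Lka KaL zL kzL V0 VK] := H.
rewrite /eps mulrAC ler_pdivlMr ?exprn_gt0// mul1r.
have : L ^+ 2 <= (k * a ^+ 2) ^+ 2.
  by rewrite ler_sqr ?nnegrE// ?mulr_ge0 ?exprn_ge0 ?ltW.
move=> h; have := ler_wpM2l (ltW L0) h; lra.
Qed.

Lemma eps_ge0 : 0 <= eps.
Proof.
have [k0 L0 a0 K1 kL Lka KaL zL kzL V0 VK] := H.
by rewrite divr_ge0 ?mulr_ge0 ?exprn_ge0 ?ltW. Qed.

Lemma eps_a2 : a ^+ 2 <= eps * L ^+ 2.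
Proof.
have [k0 L0 a0 K1 kL Lka KaL zL kzL V0 VK] := H.
rewrite /eps mulrAC ler_pdivlMr ?exprn_gt0//.
have := ler_wpM2l (ltW (mulr_gt0 (exprn_gt0 2 a0) (exprn_gt0 2 L0))) Lka; lra.
Qed.

Lemma eps_a4 : k * a ^+ 4 = eps * L ^+ 3.
Proof.
have [k0 L0 a0 K1 kL Lka KaL zL kzL V0 VK] := H.
by rewrite /eps divfK// expf_neq0// gt_eqF. Qed.

Lemma eps_V : V <= K ^+ 2 * eps * L ^+ 2.
Proof.
have [k0 L0 a0 K1 kL Lka KaL zL kzL V0 VK] := H.
apply: (le_trans VK); rewrite exprMn -mulrA ler_wpM2l ?sqr_ge0//.
exact: eps_a2.
Qed.

Lemma eps_range : `|z - L| <= K * eps * L.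
Proof.
have [k0 L0 a0 K1 kL Lka KaL zL kzL V0 VK] := H.
rewrite -(ler_pM2l k0); apply: (le_trans kzL).
have K0 : (0 : R) <= K by lra.
have := ler_wpM2l K0 eps_kL; lra.
Qed.

Lemma range_ge : L / 2 <= z.
Proof.
have [k0 L0 a0 K1 kL Lka KaL zL kzL V0 VK] := H.
by move: zL; rewrite ler_norml => /andP[]; lra. Qed.

Lemma range_le : z <= 3 * L / 2.
Proof.
have [k0 L0 a0 K1 kL Lka KaL zL kzL V0 VK] := H.
by move: zL; rewrite ler_norml => /andP[]; lra. Qed.

Lemma range_gt0 : 0 < z.
Proof.
have [k0 L0 a0 K1 kL Lka KaL zL kzL V0 VK] := H.
by have := range_ge; lra. Qed.

Lemma dist_sqr : r ^+ 2 = V + z ^+ 2.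
Proof.
have [k0 L0 a0 K1 kL Lka KaL zL kzL V0 VK] := H.
by rewrite sqr_sqrtr// addr_ge0 ?sqr_ge0. Qed.

Lemma range_le_dist : z <= r.
Proof.
have [k0 L0 a0 K1 kL Lka KaL zL kzL V0 VK] := H.
rewrite -[X in X <= _](ger0_norm (ltW range_gt0)) -sqrtr_sqr ler_wsqrtr//.
by rewrite lerDr.
Qed.

Lemma dist_gt0 : 0 < r.
Proof.
have [k0 L0 a0 K1 kL Lka KaL zL kzL V0 VK] := H.
exact: lt_le_trans range_gt0 range_le_dist. Qed.

(** [(r - z) (r + z) = V], and [r + z >= L] since both terms are at least [L / 2]. *)
Lemma dist_range_le : r - z <= K ^+ 2 * eps * L.
Proof.
have [k0 L0 a0 K1 kL Lka KaL zL kzL V0 VK] := H.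
have h1 := range_le_dist; have h2 := range_ge; have h3 := dist_sqr; have h4 := eps_V.
rewrite -(ler_pM2r L0).
have : (r - z) * L <= (r - z) * (r + z) by apply: ler_wpM2l; lra.
rewrite -subr_sqr h3; lra.
Qed.

Lemma spreading_approx : `|L / r - 1| <= 4 * K ^+ 2 * eps.
Proof.
have [k0 L0 a0 K1 kL Lka KaL zL kzL V0 VK] := H.
have r0 := dist_gt0; have h1 := range_le_dist; have h2 := range_ge.
rewrite (_ : L / r - 1 = (L - r) / r); last by field; rewrite gt_eqF.
rewrite normf_div (gtr0_norm r0) ler_pdivrMr//.
have h3 : `|L - r| <= (K + K ^+ 2) * eps * L.
  rewrite (_ : L - r = (L - z) + (z - r)); last by ring.
  apply: (le_trans (ler_normD _ _)); rewrite distrC.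
  rewrite (_ : (K + _) * _ * _ = K * eps * L + K ^+ 2 * eps * L); last by ring.
  rewrite lerD ?eps_range// distrC ger0_norm ?dist_range_le//.
  by rewrite subr_ge0.
apply: (le_trans h3).
have e0 := eps_ge0.
have KK : K <= K ^+ 2 by nra.
have h5 : 4 * K ^+ 2 * eps * (L / 2) <= 4 * K ^+ 2 * eps * r.
  by apply: ler_wpM2l; [nra|lra].
apply: le_trans h5.
rewrite (_ : 4 * _ * _ * _ = (K ^+ 2 + K ^+ 2) * eps * L); last by field.
by do 2 (apply: ler_wpM2r; [lra|]); lra.
Qed.

(** The paraxial distance [s] satisfies [s^2 - r^2 = V^2 / (4 z^2)] exactly, so no Taylor remainder
    is needed. Two errors remain: [A], from the expansion, of order [k a^4 / L^3], which is where
    [eps] comes from; and [B], from replacing [z] by [L] under [V], where the bound on [k |z - L|]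
    enters. *)
Lemma fresnel_phase : `|k * r - (k * z + k * V / (2 * L))| <= 2 * K ^+ 4 * eps.
Proof.
have [k0 L0 a0 K1 kL Lka KaL zL kzL V0 VK] := H.
have r0 := dist_gt0; have h1 := range_le_dist; have h2 := range_ge.
have z0 := range_gt0.
pose s := z + V / (2 * z).
have sr : s ^+ 2 - r ^+ 2 = V ^+ 2 / (4 * z ^+ 2).
  by rewrite dist_sqr /s; field; rewrite gt_eqF.
have Vz0 : 0 <= V / (2 * z) by rewrite divr_ge0// mulr_ge0// ltW.
have s0 : z <= s by rewrite /s lerDl.
have rs : r <= s.
  rewrite -ler_sqr ?nnegrE; [|lra|lra].
  by rewrite -subr_ge0 sr divr_ge0 ?sqr_ge0// mulr_ge0// sqr_ge0.
have e0 := eps_ge0.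
have L3 : 0 < L ^+ 3 by rewrite exprn_gt0.
have A : k * (s - r) <= K ^+ 4 * eps.
  have h : (s - r) * L ^+ 3 <= V ^+ 2.
    have : (s - r) * L <= V ^+ 2 / (4 * z ^+ 2).
      by rewrite -sr subr_sqr ler_wpM2l; lra.
    rewrite ler_pdivlMr ?mulr_gt0 ?exprn_gt0// => h.
    apply: le_trans h.
    rewrite (_ : (s - r) * L ^+ 3 = (s - r) * L * L ^+ 2); last by ring.
    apply: ler_wpM2l; first by rewrite mulr_ge0; lra.
    have L2 := ltW (divr_gt0 L0 (ltr0Sn R 1)).
    have := ler_pM L2 L2 h2 h2; lra.
  rewrite -(ler_pM2r L3) -[X in _ <= X]mulrA -eps_a4.
  rewrite -mulrA; apply: (le_trans (ler_wpM2l (ltW k0) h)).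
  have V2 : V ^+ 2 <= ((K * a) ^+ 2) ^+ 2 by rewrite ler_sqr ?nnegrE// sqr_ge0.
  have := ler_wpM2l (ltW k0) V2; lra.
have B : `|k * V / (2 * z) - k * V / (2 * L)| <= K ^+ 3 * eps.
  rewrite (_ : _ - _ = V * (k * (L - z)) / (2 * z * L)); last first.
    by field; rewrite !gt_eqF.
  have zL0 : 0 < 2 * z * L by rewrite !mulr_gt0.
  rewrite normf_div (gtr0_norm zL0) ler_pdivrMr// !normrM.
  rewrite (ger0_norm V0) (gtr0_norm k0) distrC.
  apply: (le_trans (ler_pM V0 _ eps_V kzL)); first by rewrite mulr_ge0 ?normr_ge0 ?ltW.
  have Kp : 0 <= K ^+ 3 * eps by rewrite mulr_ge0// exprn_ge0//; lra.
  rewrite (_ : K ^+ 2 * eps * L ^+ 2 * K = K ^+ 3 * eps * (L * L)); last by ring.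
  by apply: ler_wpM2l => //; apply: ler_wpM2r; lra.
have KK : K ^+ 3 <= K ^+ 4 by rewrite ler_weXn2l.
rewrite (_ : _ - _ = (k * V / (2 * z) - k * V / (2 * L)) - k * (s - r)); last first.
  by rewrite /s; field; rewrite !gt_eqF.
apply: (le_trans (ler_normB _ _)).
rewrite [X in _ + X]ger0_norm; last by rewrite mulr_ge0; lra.
have := ler_wpM2r e0 KK; lra.
Qed.

(** [|m(s)| <= (s + 1) / s^2 <= 2 / s] for [s >= 1], and [k r >= k L / 2 >= 1]. The first bound
    measures the near-field error. The second is absolute, because no upper bound on [eps] is
    assumed here. *)
Lemma mfun_bound :
  normc (Defs.mfun (k * r)) <= 4 * eps /\ normc (Defs.mfun (k * r)) <= 2.
Proof.
have [k0 L0 a0 K1 kL Lka KaL zL kzL V0 VK] := H.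
have r0 := dist_gt0; have h1 := range_le_dist; have h2 := range_ge.
have krL : k * L / 2 <= k * r by rewrite -mulrA ler_pM2l//; lra.
have s1 : 1 <= k * r by lra.
set s := k * r in krL s1 *.
have s0 : 0 < s by lra.
have ms : normc (Defs.mfun s) <= 2 / s.
  rewrite /Defs.mfun Normc.normcM Normc.normcV normc_real ger0_norm ?sqr_ge0//.
  apply: (@le_trans _ _ ((s + 1) / s ^+ 2)).
    rewrite ler_pM2r ?invr_gt0 ?exprn_gt0//.
    apply: (le_trans (ler_normcB _ _)); rewrite Normc.normc1 Normc.normcM normc_i mul1r.
    by rewrite normc_real gtr0_norm.
  rewrite ler_pdivrMr ?exprn_gt0// (_ : 2 / s * _ = 2 * s); last first.
    by field; rewrite gt_eqF.
  lra.
split; apply: (le_trans ms); rewrite ler_pdivrMr//; last lra.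
have := eps_kL; have := ler_wpM2l eps_ge0 krL; lra.
Qed.

(** [d] stands for an entry of the identity, [x] for one of the projection on the line of sight, [A]
    for the limit. The bracket is [(d - x) + m (d - 3 x)], and [|d - 3 x| <= 4] gives 16. *)
Lemma polarization_approx (m : R[i]) (d x A C : R) :
  normc m <= 4 * eps -> `|d| <= 1 -> `|x| <= 1 -> `|d - x - A| <= C * eps ->
  normc ((1 + m) * d%:C - (1 + 3 * m) * x%:C - A%:C) <= (C + 16) * eps.
Proof.
have [k0 L0 a0 K1 kL Lka KaL zL kzL V0 VK] := H.
move=> hm hd hx hA.
rewrite (_ : _ - _ = (d - x - A)%:C + m * (d - 3 * x)%:C); last first.
  by rewrite !rmorphB !rmorphM /=; ring.
apply: (le_trans (le_normcD _ _)).
rewrite normc_real [X in _ <= X]mulrDl lerD// Normc.normcM normc_real.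
have h4 : `|d - 3 * x| <= 4.
  by apply: (le_trans (ler_normB _ _)); rewrite normrM ger0_norm//; lra.
rewrite (_ : 16 * eps = 4 * eps * 4); last by ring.
by rewrite ler_pM ?normc_ge0.
Qed.

Lemma polarization_bound (m : R[i]) (d x : R) :
  normc m <= 2 -> `|d| <= 1 -> `|x| <= 1 ->
  normc ((1 + m) * d%:C - (1 + 3 * m) * x%:C) <= 10.
Proof.
move=> hm hd hx.
rewrite (_ : _ - _ = (d - x)%:C + m * (d - 3 * x)%:C); last first.
  by rewrite !rmorphB !rmorphM /=; ring.
apply: (le_trans (le_normcD _ _)); rewrite Normc.normcM !normc_real.
have h1 := ler_normB d x.
have h4 : `|d - 3 * x| <= 4.
  by apply: (le_trans (ler_normB _ _)); rewrite normrM ger0_norm//; lra.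
have : normc m * `|d - 3 * x| <= 2 * 4 by rewrite ler_pM ?normc_ge0.
lra.
Qed.

End FarFieldScalars.

(** * Entrywise approximation of the dyadic Green function *)

Section GreenApproximation.
Context {R : realType}.
Implicit Types (u : R * R) (v y : 'cV[R]_2) (k L a K z : R).

Definition cross_sqr v : R := v 0 0 ^+ 2 + v 1 0 ^+ 2.

Lemma cross_sqr_ge0 v : 0 <= cross_sqr v.
Proof. by rewrite addr_ge0 ?sqr_ge0. Qed.

Lemma sqr_coord_le v i : v i 0 ^+ 2 <= cross_sqr v.
Proof.
have [->|->] := ord2_cases i.
  by rewrite lerDl sqr_ge0.
by rewrite lerDr sqr_ge0.
Qed.

Lemma receiver_sub u y z : receiver u - mkpoint y z = mkpoint (cvec u - y) (- z).
Proof.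
by rewrite /receiver /mkpoint opp_col_mx add_col_mx -!raddfN -raddfD /= add0r.
Qed.

Lemma mkpoint_lshift v z i : mkpoint v z (lshift 1 i) 0 = v i 0.
Proof. by rewrite /mkpoint col_mxEu. Qed.

Lemma mkpoint_rshift v z i : mkpoint v z (rshift 2 i) 0 = z.
Proof. by rewrite /mkpoint col_mxEd mxE !ord1 eqxx mulr1n. Qed.

Lemma enorm_mkpoint v z : enorm (mkpoint v z) = Num.sqrt (cross_sqr v + z ^+ 2).
Proof.
rewrite /enorm big_split_ord /= big_ord1 mkpoint_rshift; congr (Num.sqrt (_ + _)).
rewrite big_ord_recl big_ord1 !mkpoint_lshift; congr (_ + v _ _ ^+ _).
exact/val_inj.
Qed.

Lemma dyadic_greenE u y z k i j :
  let v := cvec u - y in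
  let r := Num.sqrt (cross_sqr v + z ^+ 2) in
  let m := Defs.mfun (k * r) in
  let rho := mkpoint v (- z) in
  dyadic_green (receiver u) (mkpoint y z) k i j =
  expi (k * r) / (4 * pi * r)%:C *
  ((1 + m) * ((i == j)%:R)%:C
   - (1 + 3 * m) * ((r ^+ 2)^-1 * (rho i 0 * rho j 0))%:C).
Proof.
move=> v r m rho; rewrite /dyadic_green receiver_sub -/v -/rho enorm_mkpoint.
rewrite sqrrN -/r -/m.
rewrite /green receiver_sub enorm_mkpoint -/v sqrrN -/r.
rewrite !mxE big_ord1 !mxE; congr (_ * (_ * _ - _)).
by rewrite rmorph_nat.
Qed.

(* Leading order, in block form (cross-range, range), of the bracket in the
   dyadic Green function. *)
Definition far_polarization L v : 'M[R]_(2 + 1) :=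
  block_mx 1%:M (L^-1 *: v) (L^-1 *: v^T) 0.

Section OnePoint.
Context {k L a K z : R} {v : 'cV[R]_2}.
Hypothesis H : far_field k L a K z (cross_sqr v).
Let eps := k * a ^+ 4 / L ^+ 3.

Lemma coord_le i : `|v i 0| <= K * a.
Proof.
have [k0 L0 a0 K1 kL Lka KaL zL kzL V0 VK] := H.
rewrite -ler_sqr ?nnegrE// ?mulr_ge0//; try lra.
by rewrite real_normK ?num_real//; apply: (le_trans (sqr_coord_le v i)).
Qed.

Lemma far_polarization_le1 i j : `|far_polarization L v i j| <= 1.
Proof.
have [k0 L0 a0 K1 kL Lka KaL zL kzL V0 VK] := H.
have h l : `|L^-1 * v l 0| <= 1.
  rewrite normrM normfV (gtr0_norm L0) ler_pdivrMl// mulr1.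
  exact: le_trans (coord_le l) KaL.
rewrite /far_polarization.
case: (split_ordP i) => i' ->; case: (split_ordP j) => j' ->.
- by rewrite block_mxEul mxE; case: (_ == _); rewrite ?normr1 ?normr0.
- by rewrite block_mxEur mxE !ord1.
- by rewrite block_mxEdl !mxE !ord1.
- by rewrite block_mxEdr mxE normr0.
Qed.

(** A cross-range entry is off by [v_i v_j / r^2] and the range entry by [1 - z^2 / r^2 = V / r^2],
    both of order [a^2 / L^2]. The mixed entries, of size [a / L], are the ones that also feel
    [z - L]. *)
Lemma far_polarization_approx i j :
  let r := Num.sqrt (cross_sqr v + z ^+ 2) in
  let rho := mkpoint v (- z) in
  let d := (i == j)%:R : R in
  let x := (r ^+ 2)^-1 * (rho i 0 * rho j 0) in
  [/\ `|d| <= 1, `|x| <= 1 & `|d - x - far_polarization L v i j| <= 10 * K ^+ 2 * eps].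
Proof.
move=> r rho d x.
have [k0 L0 a0 K1 kL Lka KaL zL kzL V0 VK] := H.
have r2 : r ^+ 2 = cross_sqr v + z ^+ 2 by exact: dist_sqr H.
have r0 : 0 < r by exact: dist_gt0 H.
have rr : 0 < r ^+ 2 by rewrite exprn_gt0.
have zr : z <= r by exact: range_le_dist H.
have z2 := range_ge H; have z3 := range_le H.
have e0 : 0 <= eps by exact: eps_ge0 H.
have eV : cross_sqr v <= K ^+ 2 * eps * L ^+ 2 by exact: eps_V H.
have eR : `|z - L| <= K * eps * L by exact: eps_range H.
have KK : K <= K ^+ 2 by nra.
have K0 : (0 : R) <= K by lra.
have rL : L ^+ 2 / 4 <= r ^+ 2 by rewrite r2; nra.
have Ke : 0 <= K ^+ 2 * eps by apply: mulr_ge0 => //; exact: sqr_ge0.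
have Vr : cross_sqr v / r ^+ 2 <= 4 * K ^+ 2 * eps.
  rewrite ler_pdivrMr//.
  have : 4 * K ^+ 2 * eps * (L ^+ 2 / 4) <= 4 * K ^+ 2 * eps * r ^+ 2.
    by apply: ler_wpM2l; [lra|exact: rL].
  lra.
have rhor l : `|rho l 0| <= r.
  rewrite -ler_sqr ?nnegrE ?(ltW r0)// real_normK ?num_real// r2.
  rewrite /rho; case: (split_ordP l) => l' ->.
    rewrite mkpoint_lshift; apply: (le_trans (sqr_coord_le v l')).
    by rewrite lerDl sqr_ge0.
  by rewrite mkpoint_rshift sqrrN lerDr.
split.
- by rewrite /d; case: (_ == _); rewrite ?normr1 ?normr0.
- rewrite /x normrM normfV (gtr0_norm rr) ler_pdivrMl// mulr1 normrM expr2.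
  exact: ler_pM.
(* The receiver lies at range 0, so the range component of the difference is [- z] and the two signs
   cancel. The error factors as [v / L], at most 1, times [(z (L - z) - V) / r^2]. *)
have cr l : `|- ((r ^+ 2)^-1 * (v l 0 * - z)) - L^-1 * v l 0| <= 10 * K ^+ 2 * eps.
  rewrite (_ : _ - _ = v l 0 / L * ((z * (L - z) - cross_sqr v) / r ^+ 2)); last first.
    have -> : z * (L - z) - cross_sqr v = z * L - r ^+ 2 by rewrite r2; ring.
    by field; rewrite !gt_eqF.
  rewrite normrM -[X in _ <= X]mul1r ler_pM//.
    rewrite normf_div (gtr0_norm L0) ler_pdivrMr// mul1r.
    exact: le_trans (coord_le l) KaL.
  rewrite normf_div (gtr0_norm rr) ler_pdivrMr//.
  have h1 : `|z * (L - z) - cross_sqr v| <= (5 / 2) * K ^+ 2 * eps * L ^+ 2.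
    apply: (le_trans (ler_normB _ _)); rewrite normrM distrC (ger0_norm V0).
    have zp : 0 < z by exact: range_gt0 H.
    rewrite (gtr0_norm zp).
    have h : z * `|z - L| <= (3 * L / 2) * (K ^+ 2 * eps * L).
      apply: ler_pM => //; first exact: ltW.
      apply: (le_trans eR); do 2 (apply: ler_wpM2r; first lra); lra.
    lra.
  apply: (le_trans h1).
  have : 10 * K ^+ 2 * eps * (L ^+ 2 / 4) <= 10 * K ^+ 2 * eps * r ^+ 2.
    by apply: ler_wpM2l; [lra|exact: rL].
  lra.
rewrite /d /x /rho /far_polarization.
case: (split_ordP i) => i' ->; case: (split_ordP j) => j' ->.
- rewrite !mkpoint_lshift block_mxEul mxE (inj_eq (@lshift_inj 2 1)).
  rewrite addrAC subrr sub0r normrN.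
  have h : `|v i' 0 * v j' 0| <= cross_sqr v.
    rewrite normrM.
    have := sqr_coord_le v i'; have := sqr_coord_le v j'.
    rewrite -(real_normK (num_real (v i' 0))) -(real_normK (num_real (v j' 0))).
    have := sqr_ge0 (`|v i' 0| - `|v j' 0|); lra.
  rewrite normrM normfV (gtr0_norm rr) mulrC.
  apply: (@le_trans _ _ (cross_sqr v / r ^+ 2)); first by rewrite ler_pM2r ?invr_gt0.
  lra.
- rewrite mkpoint_lshift mkpoint_rshift block_mxEur mxE eq_lrshift sub0r ord1.
  exact: cr.
- rewrite mkpoint_lshift mkpoint_rshift block_mxEdl !mxE eq_rlshift sub0r ord1.
  by rewrite [- z * _]mulrC; exact: cr.
- rewrite !mkpoint_rshift block_mxEdr mxE !ord1 eqxx mulr1n subr0.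
  rewrite (_ : _ - _ = cross_sqr v / r ^+ 2); last first.
    have -> : cross_sqr v = r ^+ 2 - z ^+ 2 by rewrite r2; ring.
    by field; rewrite gt_eqF.
  rewrite ger0_norm; last by rewrite divr_ge0// ltW.
  lra.
Qed.

(** Three factors are replaced in turn: the spreading [L / r] by 1, the phase, and the bracket [P]
    by its limit. With [|P| <= 10] the errors are 40, 40 and 26 times [K^4 eps], whence 106. *)
Lemma green_approx u y i j : v = cvec u - y ->
  normc ((4 * pi * L)%:C * dyadic_green (receiver u) (mkpoint y z) k i j
         - expi (k * z + k * cross_sqr v / (2 * L)) * (far_polarization L v i j)%:C)
  <= 106 * K ^+ 4 * eps.
Proof.
move=> vE; rewrite dyadic_greenE -vE.
have [k0 L0 a0 K1 kL Lka KaL zL kzL V0 VK] := H.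
set r := Num.sqrt _; set m := Defs.mfun _; set ph := k * z + _.
set A := far_polarization L v i j.
set d := (i == j)%:R; set x := (r ^+ 2)^-1 * _.
have [m1 m2] : normc m <= 4 * eps /\ normc m <= 2 by exact: mfun_bound H.
have [d1 x1 dx] := far_polarization_approx i j.
rewrite -/r -/d -/x -/A in d1 x1 dx.
have r0 : 0 < r by exact: dist_gt0 H.
have e0 : 0 <= eps by exact: eps_ge0 H.
have sp : `|L / r - 1| <= 4 * K ^+ 2 * eps by exact: spreading_approx H.
have fp : `|k * r - ph| <= 2 * K ^+ 4 * eps by exact: fresnel_phase H.
have pa : normc ((1 + m) * d%:C - (1 + 3 * m) * x%:C - A%:C)
    <= (10 * K ^+ 2 + 16) * eps.
  exact: polarization_approx H _ _ _ _ _ _ _ _ _.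
have pb := polarization_bound m d x m2 d1 x1.
set P := (1 + m) * d%:C - _ in pa pb *.
rewrite (_ : _ - _ = (L / r - 1)%:C * (expi (k * r) * P) +
   (expi (k * r) - expi ph) * P + expi ph * (P - A%:C)); last first.
  have -> : (4 * pi * L)%:C * (expi (k * r) / (4 * pi * r)%:C * P) =
      (L / r)%:C * (expi (k * r) * P).
    have pi0 := @pi_gt0 R.
    have -> : (4 * pi * L)%:C = (L / r)%:C * (4 * pi * r)%:C :> R[i].
      by rewrite -rmorphM /=; congr (_%:C); field; rewrite gt_eqF.
    have n0 : (4 * pi * r)%:C != 0 :> R[i].
      by rewrite (inj_eq (@complexI R)) gt_eqF// !mulr_gt0.
    move: n0; move: (4 * pi * r)%:C (L / r)%:C (expi _) => D l e n0; by field.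
  by rewrite rmorphB /=; ring.
apply: (le_trans (le_normcD _ _)); apply: (le_trans (lerD (le_normcD _ _) (lexx _))).
rewrite !Normc.normcM !normc_expi !mul1r normc_real.
have KK : K ^+ 2 <= K ^+ 4 by rewrite ler_weXn2l.
have K2 : 1 <= K ^+ 2 by rewrite exprn_ege1.
have h1 : `|L / r - 1| * normc P <= 4 * K ^+ 2 * eps * 10 by rewrite ler_pM ?normc_ge0.
have h2 : normc (expi (k * r) - expi ph) * normc P <= 2 * (2 * K ^+ 4 * eps) * 10.
  rewrite ler_pM ?normc_ge0//; apply: (le_trans (expi_lipschitz _ _)).
  by rewrite ler_pM2l.
have h3 := ler_wpM2r e0 KK; have h4 := ler_wpM2r e0 (le_trans K2 KK).
lra.
Qed.

End OnePoint.
End GreenApproximation.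

(** * Measurability and boundedness of the Green function on the array *)

Section PointSpread.
Context {R : realType}.
Implicit Types (u : R * R) (y : 'cV[R]_2) (k L a K z : R).

Lemma measurable_bounded_green a y z k i j : 0 <= a -> 0 < z ->
  measurable_bounded a (fun u => dyadic_green (receiver u) (mkpoint y z) k i j).
Proof.
move=> a0 z0.
pose c (i : 'I_2) u := cvec u i 0 - y i 0.
have mc i' : measurable_fun setT (c i').
  have [->|->] := ord2_cases i'.
  - rewrite /c; under eq_fun do rewrite cvec0; exact: measurable_funB.
  - rewrite /c; under eq_fun do rewrite cvec1; exact: measurable_funB.
have cb i' u : disk a u -> `|c i' u| <= a + `|y i' 0|.
  move=> /(disk_coord_le _ _ a0)[h1 h2].
  apply: (le_trans (ler_normB _ _)); rewrite lerD//.
  have [->|->] := ord2_cases i'.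
  - by rewrite cvec0.
  - by rewrite cvec1.
pose r u := Num.sqrt (c 0 u ^+ 2 + c 1 u ^+ 2 + z ^+ 2).
have mr : measurable_fun setT r.
  apply: measurableT_comp.
    by apply: continuous_measurable_fun; exact: sqrt_continuous.
  by apply: measurable_funD => //; apply: measurable_funD; exact: measurable_funX.
have rz u : z <= r u.
  rewrite -[X in X <= _](ger0_norm (ltW z0)) -sqrtr_sqr ler_wsqrtr//.
  by rewrite lerDr addr_ge0 ?sqr_ge0.
have r0 u : 0 < r u by exact: lt_le_trans (rz u).
have rb u : disk a u -> `|r u|
    <= Num.sqrt ((a + `|y 0 0|) ^+ 2 + (a + `|y 1 0|) ^+ 2 + z ^+ 2).
  move=> du; rewrite gtr0_norm// ler_wsqrtr// lerD// lerD//.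
    by rewrite -(real_normK (num_real (c _ _))) lerXn2r ?nnegrE ?addr_ge0// cb.
  by rewrite -(real_normK (num_real (c _ _))) lerXn2r ?nnegrE ?addr_ge0// cb.
have mV : measurable_fun setT (fun u => (r u)^-1).
  (* Since [r u >= z > 0], the inverse is a real power, whose measurability is available. *)
  rewrite [X in measurable_fun _ X](_ : _ = (fun u => r u `^ (-1))).
    exact: (measurableT_comp (measurable_powR (-1)) mr).
  by apply/funext => u; rewrite powR_inv1// ltW.
have bV : measurable_bounded a (fun u => ((r u)^-1)%:C).
  apply: (@measurable_bounded_real _ _ _ z^-1) => // u _.
  by rewrite normfV gtr0_norm ?lef_pV2 ?posrE ?r0 ?rz.
have bR : measurable_bounded a (fun u => (r u)%:C) by exact: measurable_bounded_real rb.
have bE : measurable_bounded a (fun u => expi (k * r u)).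
  have mkr : measurable_fun setT (fun u => k * r u) by exact: measurable_funM.
  split; last by exists 1 => u _; rewrite normc_expi.
  - apply: measurableT_comp mkr.
    by apply: continuous_measurable_fun; exact: continuous_cos.
  - apply: measurableT_comp mkr.
    by apply: continuous_measurable_fun; exact: continuous_sin.
have bcst := @measurable_bounded_cst R a.
have bD := @measurable_boundedD R a.
have bM := @measurable_boundedM R a.
have bN := @measurable_boundedN R a.
pose rho (l : 'I_(2 + 1)) u : R := mkpoint (cvec u - y) (- z) l 0.
have bRho l : measurable_bounded a (fun u => (rho l u)%:C).
  rewrite /rho; case: (split_ordP l) => l' ->.
    under eq_fun do rewrite mkpoint_lshift mxE [X in _ + X]mxE.
    exact: (measurable_bounded_real _ _ _ (mc l') (cb l')).
  under eq_fun do rewrite mkpoint_rshift; exact: bcst.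
have bm : measurable_bounded a (fun u => Defs.mfun (k * r u)).
  rewrite [X in measurable_bounded _ X](_ : _ = fun u =>
    ('i * (k%:C * (r u)%:C) - 1) *
    (((k ^+ 2)^-1)%:C * (((r u)^-1)%:C * ((r u)^-1)%:C))).
    apply: (bM); last by apply: (bM (fun=> _)) => //; exact: bM.
    by apply: (bD) => //; apply: (bM (fun=> 'i)) => //; exact: (bM (fun=> _)).
  apply/funext => u; rewrite /Defs.mfun -rmorphM; congr (_ * _).
  by rewrite -!rmorphM -fmorphV /= exprMn invfM; congr (_ * _)%:C; rewrite expr2 invfM.
rewrite [X in measurable_bounded _ X](_ : _ = fun u =>
  expi (k * r u) * (((4 * pi)^-1)%:C * ((r u)^-1)%:C) *
  ((1 + Defs.mfun (k * r u)) * ((i == j)%:R)%:C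
   - (1 + 3 * Defs.mfun (k * r u)) *
     (((r u)^-1)%:C * ((r u)^-1)%:C * ((rho i u)%:C * (rho j u)%:C)))).
  apply: (bM).
    by apply: (bM) => //; apply: (bM (fun=> _)).
  apply: (bD).
    by apply: (bM (fun u => 1 + Defs.mfun (k * r u))) => //; exact: (bD (fun=> 1)).
  apply: (bN); apply: (bM); first by apply: (bD (fun=> 1)) => //; exact: (bM (fun=> 3)).
  by do 2 apply: (bM) => //.
apply/funext => u; rewrite dyadic_greenE.
have -> : Num.sqrt (cross_sqr (cvec u - y) + z ^+ 2) = r u.
  by rewrite /cross_sqr /r /c !mxE.
congr (_ * _ * (_ - _ * _)).
- by rewrite -rmorphM -invfM fmorphV.
- by rewrite -!rmorphM -invfM -expr2.
Qed.

End PointSpread.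

(** * Point spread function *)

Definition far_zone {R : realType} (k L a K : R) (y : 'cV[R]_2) (z : R) : Prop :=
  forall u, disk a u -> far_field k L a K z (cross_sqr (cvec u - y)).

Lemma cV_subE {R : realType} n (v w : 'cV[R]_n) i : (v - w) i 0 = v i 0 - w i 0.
Proof. by rewrite mxE [X in _ + X]mxE. Qed.

Section PointSpread.
Context {R : realType} {k L a K : R} {y y' : 'cV[R]_2} {z z' : R}.
Hypotheses (H : far_zone k L a K y z) (H' : far_zone k L a K y' z').
Let eps := k * a ^+ 4 / L ^+ 3.
Hypothesis eps1 : eps <= 1.
Let C0 := 106 * K ^+ 4.
Let G u := dyadic_green (receiver u) (mkpoint y z) k.
Let G' u := dyadic_green (receiver u) (mkpoint y' z') k.
Let A u := far_polarization L (cvec u - y).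
Let A' u := far_polarization L (cvec u - y').
(** The part of the phase common to all receivers. It may be large, but the Fourier bounds are
    uniform in it; [(x1, x2)] is the frequency dual to [u]. *)
Let th : R := k * (z' - z) + k * (cross_sqr y' - cross_sqr y) / (2 * L).
Let x1 : R := k * (y 0 0 - y' 0 0) / L.
Let x2 : R := k * (y 1 0 - y' 1 0) / L.
Let s : R := 4 * pi * L.

Lemma fresnel_phase_diff u : 0 < L ->
  (k * z' + k * cross_sqr (cvec u - y') / (2 * L)) -
  (k * z + k * cross_sqr (cvec u - y) / (2 * L)) = affine2 th x1 x2 u.
Proof.
move=> L0; rewrite /affine2 /th /x1 /x2 /cross_sqr.
rewrite !cV_subE !cvec0 !cvec1.
by field; rewrite gt_eqF.
Qed.

(** The condition [d <= C0], which is [eps <= 1] for [d = C0 eps], keeps the quadratic term of the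
    product error linear in [d]. *)
Lemma normcM_approx (B B' E E' : R[i]) (d : R) :
  normc E <= 1 -> normc E' <= 1 -> d <= C0 ->
  normc (B - E) <= d -> normc (B' - E') <= d ->
  normc (B * B' - E * E') <= (C0 + 2) * d.
Proof.
move=> e e' dC b b'.
have nB' : normc B' <= C0 + 1.
  rewrite -(subrK E' B'); apply: (le_trans (le_normcD _ _)); rewrite lerD//.
  exact: le_trans b' dC.
rewrite (_ : _ - _ = (B - E) * B' + E * (B' - E')); last by ring.
apply: (le_trans (le_normcD _ _)); rewrite !Normc.normcM.
have h1 : normc (B - E) * normc B' <= d * (C0 + 1) by rewrite ler_pM ?normc_ge0.
have h2 : normc E * normc (B' - E') <= 1 * d by rewrite ler_pM ?normc_ge0.
lra.
Qed.

Lemma psf_integrand_approx u i j : disk a u ->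
  normc ((s ^+ 2)%:C * (conj_mx (G u) *m G' u) i j
         - ((A u *m A' u) i j)%:C * expi (affine2 th x1 x2 u)) <= 9 * C0 ^+ 2 * eps.
Proof.
move=> du; have h := H _ du; have h' := H' _ du.
have [k0 L0 a0 K1 _ _ _ _ _ _ _] := h.
have e0 : 0 <= eps by exact: eps_ge0 h.
have K4 : 1 <= K ^+ 4 by rewrite exprn_ege1.
have C1 : 106 <= C0 by rewrite /C0; lra.
rewrite -fresnel_phase_diff//.
set ph' := k * z' + _; set ph := k * z + _.
have sumC (F : 'I_(2 + 1) -> R) : (\sum_m F m)%:C = \sum_m (F m)%:C.
  exact: rmorph_sum.
rewrite !mxE mulr_sumr sumC mulr_suml -sumrB.
apply: (le_trans (normc_sum _ _ _ _)).
apply: (@le_trans _ _ (\sum_(m < 2 + 1) (C0 + 2) * (C0 * eps))).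
  apply: ler_sum => m _.
  have g := green_approx h u y i m erefl; have g' := green_approx h' u y' m j erefl.
  rewrite -/(G u) -/(A u) -/s -/eps -/ph -/C0 in g.
  rewrite -/(G' u) -/(A' u) -/s -/eps -/ph' -/C0 in g'.
  rewrite [conj_mx _ _ _]mxE.
  rewrite (_ : _ - _ =
    (((s%:C * G u i m)^*)%C * (s%:C * G' u m j)
     - ((expi ph * (A u i m)%:C)^*)%C * (expi ph' * (A' u m j)%:C))); last first.
    have cM (p q : R[i]) : conjc (p * q) = conjc p * conjc q by exact: rmorphM.
    have rM (p q : R) : (p * q)%:C = p%:C * q%:C by exact: rmorphM.
    have cR (p : R) : conjc p%:C = p%:C by rewrite /= oppr0.
    rewrite !cM !cR conj_expi [X in expi X]addrC expiD expr2 !rM.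
    by ring.
  apply: normcM_approx.
  - rewrite normc_conj Normc.normcM normc_expi mul1r normc_real.
    exact: far_polarization_le1 h _ _.
  - rewrite Normc.normcM normc_expi mul1r normc_real.
    exact: far_polarization_le1 h' _ _.
  - by rewrite -[X in _ <= X]mulr1 ler_pM2l//; lra.
  - by rewrite -rmorphB /= normc_conj.
  - exact: g'.
rewrite sumr_const card_ord -mulr_natr.
(* The 3 counts the intermediate indices of the matrix product, and [C0 >= 106] absorbs the 2. *)
have h3 : (C0 + 2) * 3 * C0 <= 9 * C0 ^+ 2 by nra.
have := ler_wpM2r e0 h3; lra.
Qed.

Lemma far_polarizationM_ul u l n :
  (A u *m A' u) (lshift 1 l) (lshift 1 n) =
  (l == n)%:R + (cvec u - y) l 0 * (cvec u - y') n 0 / L ^+ 2.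
Proof.
rewrite /A /A' /far_polarization mulmx_block block_mxEul mul1mx.
move: (cvec u - y) (cvec u - y') => v v'.
by rewrite !mxE big_ord1 !mxE expr2 invfM; congr (_ + _); ring.
Qed.

Lemma far_polarizationM_ur u l n :
  (A u *m A' u) (lshift 1 l) (rshift 2 n) = (cvec u - y') l 0 / L.
Proof.
rewrite /A /A' /far_polarization mulmx_block block_mxEur mul1mx mulmx0 addr0.
by rewrite mxE ord1 mulrC.
Qed.

(** The second term of the product block is of order [a^2 / L^2], hence goes into the error and
    raises 9 to 10. The amplitude left is constant. *)
Lemma psf_integrand_ul u l n : disk a u ->
  normc ((s ^+ 2)%:C * (conj_mx (G u) *m G' u) (lshift 1 l) (lshift 1 n)
         - (affine2 (l == n)%:R 0 0 u)%:C * expi (affine2 th x1 x2 u))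
  <= 10 * C0 ^+ 2 * eps.
Proof.
move=> du; have h := H _ du; have h' := H' _ du.
have [k0 L0 a0 K1 _ _ _ _ _ _ _] := h.
have e0 : 0 <= eps by exact: eps_ge0 h.
have K4 : 1 <= K ^+ 4 by rewrite exprn_ege1.
have C1 : 106 <= C0 by rewrite /C0; lra.
have p := psf_integrand_approx u (lshift 1 l) (lshift 1 n) du.
set W := (s ^+ 2)%:C * _ in p *.
rewrite far_polarizationM_ul in p.
set q := (cvec u - y) l 0 * _ / _ in p.
have qb : `|q| <= K ^+ 2 * eps.
  rewrite /q normf_div normrM [`|L ^+ 2|]gtr0_norm ?exprn_gt0//.
  rewrite ler_pdivrMr ?exprn_gt0//.
  apply: (@le_trans _ _ (K * a * (K * a))).
    by rewrite ler_pM ?(coord_le h) ?(coord_le h').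
  have := ler_wpM2l (sqr_ge0 K) (eps_a2 h); rewrite -/eps; lra.
rewrite (_ : _ - _ =
    (W - ((l == n)%:R + q)%:C * expi (affine2 th x1 x2 u))
    + q%:C * expi (affine2 th x1 x2 u)); last first.
  by rewrite /affine2 !mul0r !addr0 rmorphD /=; ring.
apply: (le_trans (le_normcD _ _)).
rewrite [X in _ + X]Normc.normcM normc_real normc_expi mulr1.
have K2 : K ^+ 2 <= K ^+ 4 by rewrite ler_weXn2l.
have K4C : K ^+ 4 <= C0 by rewrite /C0; lra.
have CC : C0 <= C0 ^+ 2 by rewrite expr2 ler_peMl; lra.
have K2C := le_trans K2 (le_trans K4C CC).
have := ler_wpM2r e0 K2C; lra.
Qed.

(** The range column is only of order [a / L], which can exceed [eps], so it must be kept as an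
    affine amplitude; the indicators of [l] select the coordinate of [u]. *)
Lemma psf_integrand_ur u l n : disk a u ->
  normc ((s ^+ 2)%:C * (conj_mx (G u) *m G' u) (lshift 1 l) (rshift 2 n)
         - (affine2 (- y' l 0 / L) ((l == 0)%:R / L) ((l == 1)%:R / L) u)%:C
           * expi (affine2 th x1 x2 u))
  <= 10 * C0 ^+ 2 * eps.
Proof.
move=> du; have h := H _ du.
have e0 : 0 <= eps by exact: eps_ge0 h.
have p := psf_integrand_approx u (lshift 1 l) (rshift 2 n) du.
rewrite far_polarizationM_ur in p.
rewrite (_ : affine2 (- y' l 0 / L) _ _ u = (cvec u - y') l 0 / L); last first.
  rewrite cV_subE /affine2.
  have [->|->] := ord2_cases l.
  - by rewrite cvec0 /=; ring.
  - by rewrite cvec1 /=; ring.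
apply: (le_trans p).
by have : 0 <= C0 ^+ 2 * eps; [rewrite mulr_ge0// sqr_ge0|lra].
Qed.

End PointSpread.

(** The receiver at the centre of the array witnesses the parameter inequalities and bounds [y]
    itself. *)
Lemma far_zone_center {R : realType} {k L a K : R} {y : 'cV[R]_2} {z : R} :
  0 < a -> far_zone k L a K y z -> far_field k L a K z (cross_sqr y).
Proof.
move=> a0 /(_ (0, 0)); rewrite (_ : cross_sqr (cvec (0, 0) - y) = cross_sqr y).
  by apply; apply/(diskE _ _ (ltW a0)); rewrite /= expr0n addr0 sqr_ge0.
by rewrite /cross_sqr !cV_subE cvec0 cvec1 !sub0r !sqrrN.
Qed.

(** * Decay of the point spread function *)

Section PointSpreadIntegral.
Context {R : realType} {k L a K : R} {y y' : 'cV[R]_2} {z z' : R}.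
Hypothesis a_gt0 : 0 < a.
Hypotheses (H : far_zone k L a K y z) (H' : far_zone k L a K y' z').
Let eps := k * a ^+ 4 / L ^+ 3.
Hypothesis eps1 : eps <= 1.
Let C1 := 10 * (106 * K ^+ 4) ^+ 2.
Let S := (4 * pi * L) ^+ 2.
Let x := mkpoint y z.
Let x' := mkpoint y' z'.

Lemma measurable_bounded_psf i j : measurable_bounded a (fun u =>
  (conj_mx (dyadic_green (receiver u) x k) *m dyadic_green (receiver u) x' k) i j).
Proof.
have z0 := range_gt0 (far_zone_center a_gt0 H).
have z0' := range_gt0 (far_zone_center a_gt0 H').
under eq_fun do rewrite mxE; apply: measurable_bounded_sum => m.
apply: measurable_boundedM; last exact: measurable_bounded_green (ltW _) _.
under eq_fun do rewrite mxE.
by apply: measurable_bounded_conj; exact: measurable_bounded_green (ltW _) _.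
Qed.

Lemma psf_affine_approx i j (c x1 x2 p q1 q2 : R) :
  (forall u, disk a u -> normc (S%:C *
     (conj_mx (dyadic_green (receiver u) x k) *m dyadic_green (receiver u) x' k) i j
     - (affine2 p q1 q2 u)%:C * expi (affine2 c x1 x2 u)) <= C1 * eps) ->
  normc (S%:C * psf a k x x' i j - Cintegral (disk a)
    (fun u => (affine2 p q1 q2 u)%:C * expi (affine2 c x1 x2 u)))
  <= 8 * C1 * eps * a ^+ 2.
Proof.
move=> hu; have a0 := ltW a_gt0.
have e0 : 0 <= eps by exact: eps_ge0 (far_zone_center a_gt0 H).
have C10 : 0 <= C1 by rewrite /C1 mulr_ge0// sqr_ge0.
have mP := measurable_bounded_psf i j.
have mT := measurable_bounded_affine2_expi a p q1 q2 c x1 x2 a0.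
have mSP : measurable_bounded a (fun u => S%:C *
     (conj_mx (dyadic_green (receiver u) x k) *m dyadic_green (receiver u) x' k) i j).
  by apply: measurable_boundedM => //; exact: measurable_bounded_cst.
rewrite /psf mxE -CintegralZl// -[X in normc (_ + X)]mulN1r -CintegralZl//.
have mN : measurable_bounded a (fun u =>
    -1 * ((affine2 p q1 q2 u)%:C * expi (affine2 c x1 x2 u))).
  by apply: measurable_boundedM => //; exact: measurable_bounded_cst.
rewrite -CintegralD// (_ : 8 * C1 * eps = 8 * (C1 * eps)); last by ring.
apply: Cintegral_bound => //; first exact: mulr_ge0.
  exact: measurable_boundedD.
by move=> u du; rewrite mulN1r; exact: hu.
Qed.

(** The separation is measured in cross-range, since the range difference enters only the constant
    phase. All three columns are covered, as dipoles may have a range polarization. In each the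
    amplitude has weight at most 3, and [48 = 16 * 3]. *)
Lemma psf_off_diagonal l j : 0 < enorm (y - y') ->
  normc (psf a k x x' (lshift 1 l) j) * S <=
    a ^+ 2 * (8 * C1 * eps + 48 * (L / (a * k * enorm (y - y')))).
Proof.
move=> d0.
have h := far_zone_center a_gt0 H; have h' := far_zone_center a_gt0 H'.
have [k0 L0 _ K1 _ _ KaL _ _ _ _] := h.
have a0 := ltW a_gt0.
have aL : a <= L by apply: le_trans KaL; rewrite ler_peMl.
have S0 : 0 <= S by exact: sqr_ge0.
pose x1 : R := k * (y 0 0 - y' 0 0) / L.
pose x2 : R := k * (y 1 0 - y' 1 0) / L.
set d := enorm _ in d0 *.
have xd : Num.sqrt (x1 ^+ 2 + x2 ^+ 2) = k * d / L.
  rewrite (_ : _ + _ = (k / L) ^+ 2 *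
    ((y 0 0 - y' 0 0) ^+ 2 + (y 1 0 - y' 1 0) ^+ 2)); last first.
    by rewrite /x1 /x2; field; rewrite gt_eqF.
  rewrite sqrtrM ?sqr_ge0// sqrtr_sqr ger0_norm ?divr_ge0 ?ltW//.
  by rewrite /d enormE2 !cV_subE mulrAC.
have xd0 : 0 < Num.sqrt (x1 ^+ 2 + x2 ^+ 2) by rewrite xd divr_gt0 ?mulr_gt0.
have key (p q1 q2 c : R) : `|p| + 2 * (a * (`|q1| + `|q2|)) <= 3 ->
  normc (S%:C * psf a k x x' (lshift 1 l) j - Cintegral (disk a)
    (fun u => (affine2 p q1 q2 u)%:C * expi (affine2 c x1 x2 u)))
  <= 8 * C1 * eps * a ^+ 2 ->
  normc (psf a k x x' (lshift 1 l) j) * S <=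
    a ^+ 2 * (8 * C1 * eps + 48 * (L / (a * k * d))).
  move=> pq hI.
  have -> : normc (psf a k x x' (lshift 1 l) j) * S =
      normc (S%:C * psf a k x x' (lshift 1 l) j).
    by rewrite Normc.normcM normc_real ger0_norm// mulrC.
  rewrite -[X in normc X](subrK (Cintegral (disk a)
    (fun u => (affine2 p q1 q2 u)%:C * expi (affine2 c x1 x2 u)))).
  apply: (le_trans (le_normcD _ _)); rewrite mulrDr lerD//.
    by apply: (le_trans hI); rewrite mulrC.
  apply: (le_trans (disk_fourier _ _ _ _ _ _ _ a0 xd0)); rewrite xd.
  apply: (@le_trans _ _ (16 * a / (k * d / L) * 3)).
    apply: ler_wpM2l => //; apply/ltW/divr_gt0; first exact: mulr_gt0.
    by apply: divr_gt0 => //; exact: mulr_gt0.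
  rewrite le_eqVlt; apply/orP; left; apply/eqP; field.
  by rewrite !gt_eqF.
case: (split_ordP j) => n jE; rewrite jE in key *.
  apply: (key _ _ _ _ _ (psf_affine_approx _ _ _ _ _ _ _ _
    (fun u => psf_integrand_ul H H' eps1 u l n))).
  rewrite normr0 addr0 mulr0 mulr0 addr0.
  by case: (_ == _); rewrite ?normr1 ?normr0; lra.
apply: (key _ _ _ _ _ (psf_affine_approx _ _ _ _ _ _ _ _
  (fun u => psf_integrand_ur H H' eps1 u l n))).
have e1 : `|- y' l 0 / L| <= 1.
  rewrite normf_div normrN (gtr0_norm L0) ler_pdivrMr// mul1r.
  exact: le_trans (coord_le h' l) KaL.
have e2 : `|(l == 0)%:R / L| + `|(l == 1)%:R / L| = L^-1.
  have [->|->] := ord2_cases l.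
  - by rewrite /= mul1r mul0r normr0 addr0 gtr0_norm ?invr_gt0.
  - by rewrite /= mul1r mul0r normr0 add0r gtr0_norm ?invr_gt0.
rewrite e2.
have : a / L <= 1 by rewrite ler_pdivrMr// mul1r.
lra.
Qed.

End PointSpreadIntegral.

(** * The point spread function at coinciding points *)

Section PointSpreadDiagonal.
Context {R : realType} {k L a K : R} {y : 'cV[R]_2} {z : R}.
Hypothesis a_gt0 : 0 < a.
Hypothesis H : far_zone k L a K y z.
Let eps := k * a ^+ 4 / L ^+ 3.
Hypothesis eps1 : eps <= 1.
Let C1 := 10 * (106 * K ^+ 4) ^+ 2.
Let S := (4 * pi * L) ^+ 2.
Let x := mkpoint y z.

(** The unsimplified phase is the one that the integrand estimates produce when both points
    coincide; it is identically 0. *)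
Lemma Cintegral_affine2_expi0 (p q1 q2 : R) :
  Cintegral (disk a) (fun u => (affine2 p q1 q2 u)%:C *
    expi (affine2 (k * (z - z) + k * (cross_sqr y - cross_sqr y) / (2 * L))
       (k * (y 0 0 - y 0 0) / L) (k * (y 1 0 - y 1 0) / L) u)) = (p * disk_area a)%:C.
Proof.
rewrite -(Cintegral_affine2 _ p q1 q2 (ltW a_gt0)); congr Cintegral.
apply/funext => u; rewrite !subrr !mulr0 !mul0r addr0 /affine2 !mul0r !addr0.
by rewrite /expi cos0 sin0 mulr1.
Qed.

Lemma psf_diagonal l n :
  normc (S%:C * psf a k x x (lshift 1 l) (lshift 1 n) - ((l == n)%:R * disk_area a)%:C)
  <= 8 * C1 * eps * a ^+ 2.
Proof.
have := psf_affine_approx a_gt0 H H _ _ _ _ _ _ _ _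
  (fun u => psf_integrand_ul H H eps1 u l n).
by rewrite Cintegral_affine2_expi0.
Qed.

Lemma psf_diagonal_range l n :
  normc (psf a k x x (lshift 1 l) (rshift 2 n)) * S
  <= a ^+ 2 * (8 * C1 * eps + 4 * (`|y l 0| / L)).
Proof.
have h := far_zone_center a_gt0 H.
have [k0 L0 _ K1 _ _ KaL _ _ _ _] := h.
have S0 : 0 <= S by exact: sqr_ge0.
have := psf_affine_approx a_gt0 H H _ _ _ _ _ _ _ _
  (fun u => psf_integrand_ur H H eps1 u l n).
rewrite Cintegral_affine2_expi0 -/S -/C1 -/eps -/x => hI.
have -> : normc (psf a k x x (lshift 1 l) (rshift 2 n)) * S
  = normc (S%:C * psf a k x x (lshift 1 l) (rshift 2 n)).
  by rewrite Normc.normcM normc_real ger0_norm// mulrC.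
rewrite -[X in normc X](subrK (- y l 0 / L * disk_area a)%:C).
apply: (le_trans (le_normcD _ _)); rewrite mulrDr lerD//.
  by apply: (le_trans hI); rewrite mulrC.
rewrite normc_real normrM normf_div normrN (gtr0_norm L0).
have ar0 : 0 <= disk_area a.
  by apply: le_trans (disk_area_ge _ (ltW a_gt0)); exact: sqr_ge0.
rewrite (ger0_norm ar0).
have := ler_wpM2l (divr_ge0 (normr_ge0 (y l 0)) (ltW L0)) (disk_area_le _ (ltW a_gt0)).
lra.
Qed.

End PointSpreadDiagonal.

(** * The imaging system *)

Section LinearSystem.
Context {R : realType}.

Lemma kirchhoff_psf (N : nat) (mu omega k a : R) (y : 'I_N -> 'cV[R]_(2 + 1))
    (p : 'I_N -> 'cV[R[i]]_(2 + 1)) (x : 'cV[R]_(2 + 1)) :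
  0 <= a -> mu * omega ^+ 2 != 0 ->
  (forall j i n, measurable_bounded a (fun u =>
    (conj_mx (dyadic_green (receiver u) x k) *m
     dyadic_green (receiver u) (y j) k) i n)) ->
  kirchhoff mu omega k a y p x = \sum_(j < N) psf a k x (y j) *m p j.
Proof.
move=> a0 c0 mP; apply/matrixP => i o; rewrite ord1 {o}.
set c := mu * omega ^+ 2 in c0 *.
rewrite /kirchhoff -/c mxE [mxintegral _ _ _ _]mxE summxE.
pose F j n u := (conj_mx (dyadic_green (receiver u) x k) *m
     dyadic_green (receiver u) (y j) k) i n.
have mFp j n : measurable_bounded a (fun u => p j n 0 * F j n u).
  by apply: measurable_boundedM; [exact: measurable_bounded_cst|exact: mP].
have mS j : measurable_bounded a (fun u => \sum_(n < 2 + 1) p j n 0 * F j n u).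
  exact: measurable_bounded_sum.
rewrite (_ : (fun u => _) = fun u =>
  c%:C * \sum_(j < N) \sum_(n < 2 + 1) p j n 0 * F j n u); last first.
  apply/funext => u; rewrite /data -/c -scalemxAr mxE mulmx_sumr summxE.
  congr (_ * _); apply: eq_bigr => j _; rewrite mulmxA mxE.
  by apply: eq_bigr => n _; rewrite mulrC.
rewrite CintegralZl//; last exact: measurable_bounded_sum.
rewrite mulrA -rmorphM mulVf// mul1r Cintegral_sum//.
apply: eq_bigr => j _; rewrite Cintegral_sum// mxE.
apply: eq_bigr => n _; rewrite CintegralZl//; last exact: mP.
by rewrite mxE mulrC.
Qed.

Lemma normc_le_cnorm n (v : 'cV[R[i]]_n) i : normc (v i 0) <= cnorm v.
Proof.
rewrite -[X in X <= _]ger0_norm ?normc_ge0// -sqrtr_sqr ler_wsqrtr//.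
by rewrite (bigD1 i)//= lerDl sumr_ge0// => j _; exact: sqr_ge0.
Qed.

Lemma cnorm_le_sum (v : 'cV[R[i]]_2) : cnorm v <= normc (v 0 0) + normc (v 1 0).
Proof.
rewrite -[X in _ <= X]ger0_norm ?addr_ge0 ?normc_ge0// -sqrtr_sqr ler_wsqrtr//.
rewrite big_ord_recl big_ord1 (_ : lift _ _ = 1); last exact/val_inj.
by rewrite sqrrD addrAC lerDl mulrn_wge0// mulr_ge0 ?normc_ge0.
Qed.

(* S H is within e q of the scalar matrix A I, entrywise, with q <= A. *)
Section NearScalar.
Context {H : 'M[R[i]]_2} {S A e q : R}.
Hypotheses (S_gt0 : 0 < S) (q_gt0 : 0 < q) (qA : q <= A) (e4 : e <= 4^-1).
Hypothesis HA : forall l n, normc (S%:C * H l n - ((l == n)%:R * A)%:C) <= e * q.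

(** With [s = |v_0| + |v_1|], each row gives [q |v_l| <= q rho + e q s]. Adding the two rows,
    [s <= 2 rho + 2 e s], and [e <= 1/4] lets half of [s] be absorbed. *)
Lemma near_scalar_solution_bound (v : 'cV[R[i]]_2) rho :
  (forall l, normc ((H *m v) l 0) * S <= q * rho) -> cnorm v <= 4 * rho.
Proof.
move=> hv; apply: (le_trans (cnorm_le_sum v)).
have q0 := q_gt0; have S0 := S_gt0; have qA' := qA; have e4' := e4.
set s := normc (v 0 0) + normc (v 1 0).
have s0 : 0 <= s by rewrite addr_ge0 ?normc_ge0.
have key l : q * normc (v l 0) <= q * rho + e * q * s.
  have -> : q * rho + e * q * s =
      q * rho + e * q * normc (v 0 0) + e * q * normc (v 1 0).
    by rewrite /s; ring.
  apply: (@le_trans _ _ (A * normc (v l 0))); first by rewrite ler_wpM2r ?normc_ge0.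
  have -> : A * normc (v l 0) = normc (S%:C * (H *m v) l 0
      - (S%:C * H l 0 - ((l == 0)%:R * A)%:C) * v 0 0
      - (S%:C * H l 1 - ((l == 1)%:R * A)%:C) * v 1 0).
    have A0 : 0 <= A by lra.
    rewrite -{1}(ger0_norm A0) -normc_real -Normc.normcM; congr normc.
    rewrite mxE big_ord_recl big_ord1 (_ : lift _ _ = 1); last exact/val_inj.
    have [->|->] := ord2_cases l; rewrite /= !(mul1r, mul0r); ring.
  apply: (le_trans (ler_normcB _ _)); apply: lerD.
    apply: (le_trans (ler_normcB _ _)); apply: lerD.
      by rewrite Normc.normcM normc_real gtr0_norm// mulrC.
    by rewrite Normc.normcM ler_wpM2r ?normc_ge0.
  by rewrite Normc.normcM ler_wpM2r ?normc_ge0.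
have k0 := key 0; have k1 := key 1.
have h : q * s <= q * (2 * rho + 2 * e * s) by rewrite /s in k0 k1 *; lra.
rewrite ler_pM2l// in h.
have : e * s <= 4^-1 * s by rewrite ler_wpM2r.
lra.
Qed.

(** The preceding bound with [rho = 0] makes the kernel trivial. The transpose appears because
    [det0P] yields a left null vector. *)
Lemma near_scalar_unitmx : H \in unitmx.
Proof.
rewrite -unitmx_tr unitmxE unitfE; apply/negP => /eqP/eqP/det0P[w w0 wH].
have Hw : H *m w^T = 0 by rewrite -[H]trmxK -trmx_mul wH trmx0.
have h : cnorm w^T <= 4 * 0.
  apply: near_scalar_solution_bound => l.
  by rewrite Hw mxE Normc.normc0 mul0r mulr0.
rewrite mulr0 in h; move/negP: w0; apply; apply/eqP/rowP => l.
rewrite [RHS]mxE; apply: Normc.eq0_normc; apply/le_anti; rewrite normc_ge0 andbT.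
by apply: le_trans h; have := normc_le_cnorm _ w^T l; rewrite mxE.
Qed.

End NearScalar.
End LinearSystem.

(** * The minimal distance and the cross-talk term *)

Section Crosstalk.
Context {R : realType}.

Lemma enorm_gt0 (v : 'cV[R]_2) : v != 0 -> 0 < enorm v.
Proof.
move=> v0; rewrite lt_neqAle sqrtr_ge0 andbT eq_sym; apply: contra v0 => /eqP.
rewrite enormE2 => /eqP; rewrite sqrtr_eq0 => h.
have h0 : v 0 0 ^+ 2 = 0 by have := sqr_ge0 (v 0 0); have := sqr_ge0 (v 1 0); lra.
have h1 : v 1 0 ^+ 2 = 0 by have := sqr_ge0 (v 0 0); have := sqr_ge0 (v 1 0); lra.
apply/eqP/colP => l; rewrite mxE.
by have [->|->] := ord2_cases l; apply/eqP; rewrite -sqrf_eq0 ?h0 ?h1.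
Qed.

Lemma min_dist_attained N (J : set 'I_N) (x : 'cV[R]_2)
    (y : 'I_N -> 'cV[R]_2) :
  J !=set0 -> exists2 m, J m & min_dist J x y = enorm (x - y m).
Proof.
move=> [j jJ].
have jJ' : j \in J by rewrite inE.
case: (@Order.TotalTheory.arg_minP _ _ _ j (fun m => m \in J)
  (fun m => enorm (x - y m)) jJ') => m mJ hm.
rewrite inE in mJ; exists m => //; apply/le_anti/andP; split.
  apply: ge_inf; last by exists m.
  by exists 0 => _ [n _ <-]; exact: sqrtr_ge0.
apply: lb_le_inf; first by exists (enorm (x - y m)); exists m.
by move=> _ [n nJ <-]; apply: hm; rewrite inE.
Qed.

(** Attainment makes the minimal distance positive. This matters since the inverse of 0 is 0: a zero
    minimum would make the cross-talk term vanish instead of blow up. *)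
Lemma crosstalk_ge N (J : set 'I_N) (L a k : R) (x : 'cV[R]_2)
    (y : 'I_N -> 'cV[R]_2) j :
  0 < L -> 0 < a -> 0 < k -> (forall m, J m -> 0 < enorm (x - y m)) -> J j ->
  L / (a * k * enorm (x - y j)) <= crosstalk J L a k x y.
Proof.
move=> L0 a0 k0 d0 jJ.
have J0 : J !=set0 by exists j.
rewrite /crosstalk ifF; last by apply/negP => /eqP; apply/eqP/set0P.
have [m mJ mE] := min_dist_attained _ J x y J0.
have dm := d0 _ mJ; have dj := d0 _ jJ.
rewrite ler_pM2l// lef_pV2 ?posrE ?mulr_gt0// ?mE//.
rewrite ler_pM2l ?mulr_gt0// -mE; apply: ge_inf; last by exists j.
by exists 0 => _ [n _ <-]; exact: sqrtr_ge0.
Qed.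

Lemma crosstalk_ge0 N (J : set 'I_N) (L a k : R) (x : 'cV[R]_2)
    (y : 'I_N -> 'cV[R]_2) :
  0 < L -> 0 < a -> 0 < k -> 0 <= crosstalk J L a k x y.
Proof.
move=> L0 a0 k0; rewrite /crosstalk; case: ifPn => // /set0P J0.
have [m _ ->] := min_dist_attained _ J x y J0.
by rewrite divr_ge0 ?mulr_ge0 ?sqrtr_ge0 ?ltW.
Qed.

End Crosstalk.

Lemma mkpoint_inj {R : realType} (y y' : 'cV[R]_2) (z z' : R) :
  mkpoint y z = mkpoint y' z' -> y = y' /\ z = z'.
Proof.
move=> e; split.
  by apply/colP => i; rewrite -(mkpoint_lshift y z) e mkpoint_lshift.
by rewrite -(mkpoint_rshift y z 0) e mkpoint_rshift.
Qed.

(** In [K], the part [2 + 2 |Cb|] comes from [|u - y|^2 <= 2 |u|^2 + 2 |y|^2] with [b <= a], and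
    [|Ch| |M|] bounds [k |eta|]. Absolute values appear because the window constants are arbitrary
    reals. *)
Lemma window_far_zone {R : realType} (k L a b h M Cb Ch : R) (y : 'cV[R]_2) (eta : R) :
  let K := 2 + 2 * `|Cb| + `|Ch| * `|M| in
  0 < k -> 0 < L -> 0 < a -> 0 < b -> b <= a -> 0 < h ->
  2 <= k * L -> L <= k * a ^+ 2 -> K * a <= L ->
  `|Ch| * h <= L / 2 -> k * h <= M ->
  in_window Cb Ch b h y eta -> far_zone k L a K y (L + eta).
Proof.
move=> K k0 L0 a0 b0 ba h0 kL Lka KaL hL khM [yb eb] u du.
have Ce : `|eta| <= `|Ch| * h.
  by apply: (le_trans eb); rewrite ler_wpM2r ?ler_norm// ltW.
have CM : 0 <= `|Ch| * `|M| by rewrite mulr_ge0.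
have Cb0 := normr_ge0 Cb.
have Lz : L + eta - L = eta by rewrite addrAC subrr add0r.
have K1 : 1 <= K by rewrite /K; lra.
have keta : k * `|eta| <= K.
  apply: (@le_trans _ _ (`|Ch| * `|M|)); last by rewrite /K; lra.
  apply: (@le_trans _ _ (k * (`|Ch| * h))); first by rewrite ler_pM2l.
  rewrite mulrCA ler_wpM2l//; apply: (le_trans khM); exact: ler_norm.
suff VK : cross_sqr (cvec u - y) <= (K * a) ^+ 2.
  split; rewrite ?Lz; try assumption; first exact: le_trans Ce hL.
  exact: cross_sqr_ge0.
have y2 : cross_sqr y <= (`|Cb| * a) ^+ 2.
  have -> : cross_sqr y = enorm y ^+ 2.
    by rewrite enormE2 sqr_sqrtr// cross_sqr_ge0.
  rewrite lerXn2r ?nnegrE ?sqrtr_ge0 ?mulr_ge0 ?(ltW a0)//.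
  apply: (le_trans yb); apply: (@le_trans _ _ (`|Cb| * b)).
    by rewrite ler_wpM2r ?ler_norm// ltW.
  by rewrite ler_wpM2l.
have u2 : u.1 ^+ 2 + u.2 ^+ 2 <= a ^+ 2 by exact: (diskE _ _ (ltW a0)).1.
rewrite /cross_sqr !cV_subE cvec0 cvec1 in y2 *.
have : (u.1 - y 0 0) ^+ 2 + (u.2 - y 1 0) ^+ 2 <=
   2 * (u.1 ^+ 2 + u.2 ^+ 2) + 2 * (y 0 0 ^+ 2 + y 1 0 ^+ 2).
  have := sqr_ge0 (u.1 + y 0 0); have := sqr_ge0 (u.2 + y 1 0); lra.
move=> /le_trans; apply.
have -> : (K * a) ^+ 2 = K ^+ 2 * a ^+ 2 by ring.
have hK : 2 + 2 * `|Cb| ^+ 2 <= K ^+ 2.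
  have : (2 + 2 * `|Cb|) ^+ 2 <= K ^+ 2 by rewrite lerXn2r ?nnegrE /K; lra.
  have := sqr_ge0 `|Cb|; nra.
have := ler_wpM2r (sqr_ge0 a) hK.
lra.
Qed.

(** * Solution estimates at fixed parameters *)

Section FixedParameters.
Context {R : realType} {N : nat}.
Context {mu omega k L a b h M Cb Ch Cp : R}.
Let K := 2 + 2 * `|Cb| + `|Ch| * `|M|.
Let eps := k * a ^+ 4 / L ^+ 3.
Let C1 := 10 * (106 * K ^+ 4) ^+ 2.
Hypotheses (mu_omega : mu * omega ^+ 2 != 0).
Hypotheses (k_gt0 : 0 < k) (L_gt0 : 0 < L) (a_gt0 : 0 < a).
Hypotheses (b_gt0 : 0 < b) (h_gt0 : 0 < h).
Hypotheses (ba : b <= a) (kL2 : 2 <= k * L).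
Hypotheses (Lka : L <= k * a ^+ 2) (KaL : K * a <= L).
Hypotheses (hL : `|Ch| * h <= L / 2) (khM : k * h <= M).
Hypothesis epsC : 8 * C1 * eps <= 4^-1.
Context {yd : 'I_N -> 'cV[R]_2} {etad : 'I_N -> R}.
Context {pd : 'I_N -> 'cV[R[i]]_(2 + 1)} {y : 'cV[R]_2} {eta : R}.
Hypotheses (wd : forall j, in_window Cb Ch b h (yd j) (etad j)).
Hypotheses (pC : forall j, cnorm (pd j) <= Cp).
Hypothesis (wy : in_window Cb Ch b h y eta).
Let dipole j := mkpoint (yd j) (L + etad j).
Let x := mkpoint y (L + eta).
Let H := ulsubmx (psf a k x x).
Let I_KM := usubmx (kirchhoff mu omega k a dipole pd x).
Let S := (4 * pi * L) ^+ 2.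
(** The 4 is that of [solution_bound]; 1 stands for the range component of the dipole being imaged,
    [3 N] for the components of the others; the last factor dominates the coefficients of [eps], of
    the cross-talk and of [b / L]. *)
Let C := 4 * `|Cp| * (1 + 3 * N%:R) * (8 * C1 + 48 + 4 * `|Cb|).

Let fz : far_zone k L a K y (L + eta).
Proof. exact: window_far_zone wy. Qed.

Let fzd j : far_zone k L a K (yd j) (L + etad j).
Proof. exact: window_far_zone (wd j). Qed.

Let K_ge1 : 1 <= K.
Proof. by case: (far_zone_center a_gt0 fz). Qed.

Let C1_ge1 : 1 <= C1.
Proof.
have K4 : 1 <= K ^+ 4 by exact: (exprn_ege1 4 K_ge1).
have : 1 <= (106 * K ^+ 4) ^+ 2 by rewrite exprn_ege1//; lra.
by rewrite /C1; lra.
Qed.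

Let eps0 : 0 <= eps.
Proof. exact: eps_ge0 (far_zone_center a_gt0 fz). Qed.

Let eps1 : eps <= 1.
Proof. have c1 := C1_ge1; have e0 := eps0; have ec := epsC; nra. Qed.

Let C1_eps X : 0 <= X -> 0 <= 8 * C1 * eps + 48 * X.
Proof.
move=> X0; have := mulr_ge0 (le_trans ler01 C1_ge1) eps0.
by move: (C1 * eps) (mulrA 8 C1 eps) => ce <-; lra.
Qed.

Let S_gt0 : 0 < S.
Proof. by rewrite exprn_gt0// !mulr_gt0// pi_gt0. Qed.

Let HE l n : H l n = psf a k x x (lshift 1 l) (lshift 1 n).
Proof. by rewrite /H /ulsubmx mxE mxE. Qed.

Let H_near_scalar l n :
  normc (S%:C * H l n - ((l == n)%:R * disk_area a)%:C) <= 4^-1 * a ^+ 2.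
Proof.
rewrite HE; apply: (le_trans (psf_diagonal a_gt0 fz eps1 l n)).
by rewrite ler_wpM2r ?sqr_ge0.
Qed.

Lemma imaging_unitmx : H \in unitmx.
Proof.
exact: (near_scalar_unitmx S_gt0 (exprn_gt0 2 a_gt0)
  (disk_area_ge _ (ltW a_gt0)) (lexx _) H_near_scalar).
Qed.

Let solution_bound (v : 'cV[R[i]]_2) rho :
  (forall l, normc ((H *m v) l 0) * S <= a ^+ 2 * rho) -> cnorm v <= 4 * rho.
Proof.
exact: (near_scalar_solution_bound S_gt0 (exprn_gt0 2 a_gt0)
  (disk_area_ge _ (ltW a_gt0)) (lexx _) H_near_scalar).
Qed.

Let kirchhoffE : kirchhoff mu omega k a dipole pd x =
  \sum_(j < N) psf a k x (dipole j) *m pd j.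
Proof.
apply: kirchhoff_psf => //; first exact: ltW.
by move=> j i n; exact: measurable_bounded_psf a_gt0 fz (fzd j) _ _.
Qed.

Let pdC j n : normc (pd j n 0) <= `|Cp|.
Proof.
apply: (le_trans (normc_le_cnorm _ _ _)); apply: (le_trans (pC j)); exact: ler_norm.
Qed.

Let dipole_response X j l : 0 < enorm (y - yd j) ->
  L / (a * k * enorm (y - yd j)) <= X ->
  normc ((psf a k x (dipole j) *m pd j) (lshift 1 l) 0) * S
    <= a ^+ 2 * (`|Cp| * 3 * (8 * C1 * eps + 48 * X)).
Proof.
move=> d0 dX.
have key n : normc (psf a k x (dipole j) (lshift 1 l) n * pd j n 0) * S
  <= a ^+ 2 * (`|Cp| * (8 * C1 * eps + 48 * X)).
  rewrite Normc.normcM mulrAC.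
  rewrite (_ : a ^+ 2 * _ = a ^+ 2 * (8 * C1 * eps + 48 * X) * `|Cp|); last by ring.
  apply: ler_pM; [|exact: normc_ge0| |exact: pdC].
    by apply: mulr_ge0; [exact: normc_ge0|exact: ltW].
  apply: (le_trans (psf_off_diagonal a_gt0 fz (fzd j) eps1 l n d0)).
  by rewrite ler_wpM2l ?sqr_ge0// lerD2l ler_pM2l.
rewrite mxE; apply: (le_trans (ler_wpM2r (ltW S_gt0) (normc_sum _ _ _ _))).
rewrite mulr_suml; apply: (le_trans (ler_sum _ (fun n _ => key n))).
rewrite sumr_const card_ord -mulr_natr le_eqVlt; apply/orP; left; apply/eqP; ring.
Qed.

Let crossed_response X (J : pred 'I_N) l : 0 <= X ->
  (forall j, J j -> 0 < enorm (y - yd j)) ->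
  (forall j, J j -> L / (a * k * enorm (y - yd j)) <= X) ->
  normc (\sum_(j | J j) (psf a k x (dipole j) *m pd j) (lshift 1 l) 0) * S
    <= a ^+ 2 * (3 * N%:R * `|Cp| * (8 * C1 * eps + 48 * X)).
Proof.
move=> X0 d0 dX.
have c1 := C1_ge1; have e0 := eps0.
apply: (le_trans (ler_wpM2r (ltW S_gt0) (normc_sum _ _ _ _))).
rewrite mulr_suml.
have pos : 0 <= a ^+ 2 * (`|Cp| * 3 * (8 * C1 * eps + 48 * X)).
  apply: mulr_ge0; [exact: sqr_ge0|apply: mulr_ge0; [exact: mulr_ge0|exact: C1_eps]].
apply: (@le_trans _ _ (\sum_(j < N) a ^+ 2 * (`|Cp| * 3 * (8 * C1 * eps + 48 * X)))).
  rewrite [X in _ <= X](bigID J) /= -[X in X <= _]addr0 lerD//; last exact: sumr_ge0.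
  by apply: ler_sum => j Jj; apply: dipole_response; [exact: d0|exact: dX].
rewrite sumr_const card_ord -mulr_natr le_eqVlt; apply/orP; left; apply/eqP; ring.
Qed.

Lemma imaging_away (p : 'cV[R[i]]_2) : (0 < N)%N -> H *m p = I_KM ->
  (forall j, y != yd j) ->
  cnorm p <= C * (crosstalk setT L a k y yd + eps).
Proof.
move=> N0 Hp yj.
have d0 j : 0 < enorm (y - yd j) by rewrite enorm_gt0// subr_eq0.
set X := crosstalk _ _ _ _ _ _.
have X0 : 0 <= X by exact: crosstalk_ge0.
have c1 := C1_ge1; have e0 := eps0.
apply: (@le_trans _ _ (4 * (3 * N%:R * `|Cp| * (8 * C1 * eps + 48 * X)))).
  apply: solution_bound => l.
  rewrite Hp /I_KM kirchhoffE mxE summxE.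
  apply: crossed_response => // j _.
  by apply: crosstalk_ge => //; move=> m _; exact: d0.
rewrite /C (_ : 4 * _ = 4 * `|Cp| * (3 * N%:R * (8 * C1 * eps + 48 * X))); last by ring.
set B := 8 * C1 + 48 + 4 * `|Cb|.
have -> : 4 * `|Cp| * (1 + 3 * N%:R) * B * (X + eps) =
  4 * `|Cp| * ((1 + 3 * N%:R) * (B * (X + eps))) by ring.
rewrite ler_wpM2l ?mulr_ge0// /B.
have hB : 8 * C1 * eps + 48 * X <= (8 * C1 + 48 + 4 * `|Cb|) * (X + eps).
  have := mulr_ge0 (normr_ge0 Cb) X0; have := mulr_ge0 (normr_ge0 Cb) e0.
  have : 0 <= C1 * X by rewrite mulr_ge0//; lra.
  lra.
by apply: ler_pM; [exact: mulr_ge0|exact: C1_eps|rewrite lerDr|exact: hB].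
Qed.

Lemma imaging_at_dipole (p : 'cV[R[i]]_2) (i : 'I_N) : H *m p = I_KM ->
  x = dipole i -> (forall j, j != i -> yd j != yd i) ->
  cnorm (p - usubmx (pd i)) <=
    C * (crosstalk [set j | j != i] L a k (yd i) yd + b / L + eps).
Proof.
move=> Hp xi yj.
have [yi _] := mkpoint_inj _ _ _ _ xi.
have d0 j : j != i -> 0 < enorm (y - yd j).
  by move=> ji; rewrite enorm_gt0// subr_eq0 yi eq_sym yj.
rewrite -yi; set X := crosstalk _ _ _ _ _ _.
have X0 : 0 <= X by exact: crosstalk_ge0.
have c1 := C1_ge1; have e0 := eps0.
have bL : 0 <= b / L by rewrite divr_ge0 ?ltW.
apply: (@le_trans _ _ (4 * (`|Cp| * (8 * C1 * eps + 4 * (`|Cb| * (b / L))) +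
    3 * N%:R * `|Cp| * (8 * C1 * eps + 48 * X)))).
  apply: solution_bound => l.
  (* The contribution of dipole [i] to the image contains [H] times its cross-range polarization
     exactly. So the error solves the same system, with only the range column at [i] and the other
     dipoles on the right. *)
  have -> : (H *m (p - usubmx (pd i))) l 0 =
     psf a k x x (lshift 1 l) (rshift 2 0) * pd i (rshift 2 0) 0
     + \sum_(j | j != i) (psf a k x (dipole j) *m pd j) (lshift 1 l) 0.
    have E1 : (psf a k x x *m pd i) (lshift 1 l) 0 = (H *m usubmx (pd i)) l 0
        + psf a k x x (lshift 1 l) (rshift 2 0) * pd i (rshift 2 0) 0.
      rewrite mxE big_split_ord /= big_ord1 [(H *m _) l 0]mxE; congr (_ + _).
      by apply: eq_bigr => n _; rewrite HE [usubmx _ _ _]mxE.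
    have E2 : (H *m p) l 0 = (psf a k x x *m pd i) (lshift 1 l) 0
        + \sum_(j | j != i) (psf a k x (dipole j) *m pd j) (lshift 1 l) 0.
      rewrite Hp /I_KM kirchhoffE [usubmx _ _ _]mxE summxE.
      by rewrite (bigD1 i) /=; [rewrite -xi|].
    by rewrite mulmxBr mxE [X in _ + X]mxE E2 E1; ring.
  apply: (le_trans (ler_wpM2r (ltW S_gt0) (le_normcD _ _))).
  rewrite mulrDl mulrDr lerD//; last first.
    apply: crossed_response => // j ji.
    by apply: crosstalk_ge => //; move=> m mi; exact: d0.
  rewrite Normc.normcM mulrAC.
  rewrite (_ : a ^+ 2 * _ =
    a ^+ 2 * (8 * C1 * eps + 4 * (`|Cb| * (b / L))) * `|Cp|); last by ring.
  apply: ler_pM; [|exact: normc_ge0| |exact: pdC].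
    by apply: mulr_ge0; [exact: normc_ge0|exact: ltW].
  apply: (le_trans (psf_diagonal_range a_gt0 fz eps1 l 0)).
  rewrite ler_wpM2l ?sqr_ge0// lerD2l ler_pM2l// mulrA ler_pM2r ?invr_gt0//.
  have [yb _] := wy.
  have yl : `|y l 0| <= enorm y.
    rewrite enormE2 -sqrtr_sqr ler_wsqrtr//; exact: sqr_coord_le.
  apply: (le_trans yl); apply: (le_trans yb); rewrite ler_wpM2r ?ler_norm//; exact: ltW.
have XbE : 0 <= X + b / L + eps by rewrite !addr_ge0.
set Y := X + b / L + eps in XbE *.
have CbX := mulr_ge0 (normr_ge0 Cb) X0; have Cbe := mulr_ge0 (normr_ge0 Cb) e0.
have Cbb := mulr_ge0 (normr_ge0 Cb) bL.
have C1X : 0 <= C1 * X by rewrite mulr_ge0//; lra.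
have C1b : 0 <= C1 * (b / L) by rewrite mulr_ge0//; lra.
have h1 : 8 * C1 * eps + 4 * (`|Cb| * (b / L)) <= (8 * C1 + 48 + 4 * `|Cb|) * Y.
  rewrite /Y; lra.
have h2 : 8 * C1 * eps + 48 * X <= (8 * C1 + 48 + 4 * `|Cb|) * Y.
  rewrite /Y; lra.
have P0 := normr_ge0 Cp.
have NP : 0 <= 3 * N%:R * `|Cp| by rewrite !mulr_ge0.
have g1 := ler_wpM2l P0 h1; have g2 := ler_wpM2l NP h2.
have -> : C * Y = 4 * (`|Cp| * ((8 * C1 + 48 + 4 * `|Cb|) * Y) +
    3 * N%:R * `|Cp| * ((8 * C1 + 48 + 4 * `|Cb|) * Y)) by rewrite /C; ring.
by rewrite ler_pM2l// lerD.
Qed.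

End FixedParameters.

(** * Passage to the Fraunhofer limit *)

Lemma much_less_near {R : realType} {T : Type} {F : set_system T} {FF : ProperFilter F}
    {X Y : T -> R} (e : R) : much_less F X Y -> 0 < e ->
  (forall t, 0 < X t) -> (forall t, 0 < Y t) -> \forall t \near F, X t < e * Y t.
Proof.
move=> XY e0 X0 Y0.
have h : \forall t \near F, `|X t / Y t| < e by exact: cvgr0_norm_lt XY _ e0.
near=> t.
have : `|X t / Y t| < e by near: t.
by rewrite gtr0_norm ?divr_gt0// ltr_pdivrMr.
Unshelve. all: by end_near. Qed.

Theorem proposition2p3 (R : realType) (c mu : R) (hc : 0 < c) (hmu : 0 < mu)
  (N : nat) (hN : (0 < N)%N)
  (T : Type) (F : set_system T) (FF : ProperFilter F)
  (omega k L a b h : T -> R)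
  (hpos : forall t : T,
     [/\ 0 < omega t, 0 < L t, 0 < a t, 0 < b t & 0 < h t])
  (hk : forall t : T, k t = omega t / c)
  (hF : fraunhofer F k L a b h)
  (Cb Ch Cp : R) :
  exists C : R, \forall t \near F,
    let Theta_a := k t * a t ^+ 2 / L t in
    let Theta_b := k t * b t ^+ 2 / L t in
    forall (yd : 'I_N -> 'cV[R]_2) (etad : 'I_N -> R)
           (pd : 'I_N -> 'cV[R[i]]_(2 + 1)) (y : 'cV[R]_2) (eta : R),
    (forall j : 'I_N, in_window Cb Ch (b t) (h t) (yd j) (etad j)) ->
    (forall j : 'I_N, cnorm (pd j) <= Cp) ->
    in_window Cb Ch (b t) (h t) y eta ->
    let dipole := fun j : 'I_N => mkpoint (yd j) (L t + etad j) in
    let x := mkpoint y (L t + eta) in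
    let H := ulsubmx (psf (a t) (k t) x x) in
    let I_KM := usubmx (kirchhoff mu (omega t) (k t) (a t) dipole pd x) in
    H \in unitmx /\
    forall p : 'cV[R[i]]_2, H *m p = I_KM ->
      (forall i : 'I_N, x = dipole i ->
         (forall j : 'I_N, j != i -> yd j != yd i) ->
         cnorm (p - usubmx (pd i)) <=
           C * (crosstalk [set j | j != i] (L t) (a t) (k t) (yd i) yd
                + b t / L t + a t ^+ 2 * Theta_a / L t ^+ 2 + Theta_b)) /\
      ((forall j : 'I_N, y != yd j) ->
         cnorm p <=
           C * (crosstalk setT (L t) (a t) (k t) y yd
                + a t ^+ 2 * Theta_a / L t ^+ 2 + Theta_b)).
Proof.
have L0 t : 0 < L t by case: (hpos t).
have a0 t : 0 < a t by case: (hpos t).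
have b0 t : 0 < b t by case: (hpos t).
have h0 t : 0 < h t by case: (hpos t).
have k0 t : 0 < k t by rewrite hk divr_gt0//; case: (hpos t).
have [M hM] := fr_kh hF.
pose K : R := 2 + 2 * `|Cb| + `|Ch| * `|M|.
pose C1 : R := 10 * (106 * K ^+ 4) ^+ 2.
have K0 : 0 < K.
  have := normr_ge0 Cb; have : 0 <= `|Ch| * `|M| by rewrite mulr_ge0.
  by rewrite /K; lra.
have C10 : 0 < C1 by rewrite !(mulr_gt0, exprn_gt0).
(* These thresholds are tuned to yield [2 <= k L], [K a <= L], [|Ch| h <= L / 2] and
   [8 C1 eps <= 1/4]; the added 1 keeps the third one meaningful when [Ch = 0]. *)
have i2 : 0 < 2^-1 :> R by [].
have iK : 0 < K^-1 by rewrite invr_gt0.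
have iC : 0 < (2 * (`|Ch| + 1))^-1 by rewrite invr_gt0 mulr_gt0// ltr_wpDl.
have iC1 : 0 < (32 * C1)^-1 by rewrite invr_gt0 mulr_gt0.
have Ta0 t : 0 < k t * a t ^+ 2 / L t by rewrite divr_gt0 ?mulr_gt0 ?exprn_gt0.
have Tb0 t : 0 < k t * b t ^+ 2 / L t by rewrite divr_gt0 ?mulr_gt0 ?exprn_gt0.
have La0 t : 0 < L t ^+ 2 / a t ^+ 2 by rewrite divr_gt0 ?exprn_gt0.
have one0 (t : T) : 0 < 1 :> R by [].
have kL0 t : 0 < k t * L t by rewrite mulr_gt0.
have n1 := much_less_near _ (fr_kL hF) i2 one0 kL0.
have n2 := much_less_near _ (fr_aL hF) iK a0 L0.
have n3 := much_less_near _ (fr_hL hF) iC h0 L0.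
have n4 := much_less_near _ (fr_Theta_b hF) ltr01 Tb0 one0.
have n5 := much_less_near _ (fr_Theta_a hF) ltr01 one0 Ta0.
have n6 := much_less_near _ (fr_Theta_aL hF) iC1 Ta0 La0.
exists (4 * `|Cp| * (1 + 3 * N%:R) * (8 * C1 + 48 + 4 * `|Cb|)).
near=> t => yd etad pd y eta wd pC wy.
have m1 : 1 < 2^-1 * (k t * L t) by near: t; exact: n1.
have m2 : a t < K^-1 * L t by near: t; exact: n2.
have m3 : h t < (2 * (`|Ch| + 1))^-1 * L t by near: t; exact: n3.
have m4 : k t * b t ^+ 2 / L t < 1 * 1 by near: t; exact: n4.
have m5 : 1 < 1 * (k t * a t ^+ 2 / L t) by near: t; exact: n5.
have m6 : k t * a t ^+ 2 / L t < (32 * C1)^-1 * (L t ^+ 2 / a t ^+ 2).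
  by near: t; exact: n6.
have m7 : `|k t * h t| <= M by near: t; exact: hM.
set Theta_b := k t * b t ^+ 2 / L t in m4 *.
have Tb : 0 <= Theta_b by exact: ltW (Tb0 t).
have -> : a t ^+ 2 * (k t * a t ^+ 2 / L t) / L t ^+ 2 = k t * a t ^+ 4 / L t ^+ 3.
  by field; rewrite gt_eqF.
have mo : mu * omega t ^+ 2 != 0.
  by case: (hpos t) => w0 *; rewrite gt_eqF// mulr_gt0 ?exprn_gt0.
have kL2 : 2 <= k t * L t by move: m1; rewrite ltr_pdivlMl// mulr1 => /ltW.
have Lka : L t <= k t * a t ^+ 2.
  by move: m5; rewrite mul1r ltr_pdivlMr// mul1r => /ltW.
have KaL : K * a t <= L t by move: m2; rewrite ltr_pdivlMl// => /ltW.
(* [Theta_b < 1 < Theta_a] gives [k b^2 < L <= k a^2]. *)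
have ba : b t <= a t.
  move: m4; rewrite mul1r ltr_pdivrMr// mul1r => m4.
  rewrite -ler_sqr ?nnegrE ?(ltW (a0 t)) ?(ltW (b0 t))//.
  by rewrite -(ler_pM2l (k0 t)) ltW// (lt_le_trans m4).
have hL : `|Ch| * h t <= L t / 2.
  move: m3; rewrite ltr_pdivlMl; last by rewrite mulr_gt0// ltr_wpDl.
  move=> /ltW m3; rewrite ler_pdivlMr//; apply: le_trans m3.
  by rewrite mulrAC ler_pM2r// mulrC ler_pM2l// lerDl.
have khM : k t * h t <= M by exact: le_trans (ler_norm _) m7.
(* [eps] is the quotient of [Theta_a] by [L^2 / a^2], so its smallness is the upper condition on
   [Theta_a]. *)
have epsC : 8 * C1 * (k t * a t ^+ 4 / L t ^+ 3) <= 4^-1.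
  have : k t * a t ^+ 4 / L t ^+ 3 <= (32 * C1)^-1.
    rewrite (_ : k t * _ / _ = k t * a t ^+ 2 / L t / (L t ^+ 2 / a t ^+ 2)).
      by rewrite ler_pdivrMr ?La0// ltW.
    by field; rewrite !gt_eqF.
  rewrite -[(32 * C1)^-1]mul1r ler_pdivlMr ?mulr_gt0// => h1.
  rewrite (_ : 8 * C1 * _ = 4^-1 * (k t * a t ^+ 4 / L t ^+ 3 * (32 * C1))).
    by rewrite ler_piMr.
  by field; rewrite gt_eqF.
have C0 : 0 <= 4 * `|Cp| * (1 + 3 * N%:R) * (8 * C1 + 48 + 4 * `|Cb|).
  by rewrite !mulr_ge0// !addr_ge0// mulr_ge0// ltW.
split.
  exact: (imaging_unitmx (k0 t) (L0 t) (a0 t) (b0 t) (h0 t) ba kL2 Lka KaL hL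
    khM epsC wy).
move=> p Hp; split=> [i xi yi|yj].
  apply: (le_trans (imaging_at_dipole mo (k0 t) (L0 t) (a0 t) (b0 t) (h0 t) ba
    kL2 Lka KaL hL khM epsC wd pC wy p i Hp xi yi)).
  by rewrite ler_wpM2l// lerDl.
apply: (le_trans (imaging_away mo (k0 t) (L0 t) (a0 t) (b0 t) (h0 t) ba kL2 Lka
  KaL hL khM epsC wd pC wy p hN Hp yj)).
by rewrite ler_wpM2l// lerDl.
Unshelve. all: by end_near. Qed.
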